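(* Let $A=(a_1,\ldots,a_n)\in\mathbb{Z}^n$ be a nonzero weight vector for an $\mathbb{S}^1$-action on $\mathbb{C}^n$. The on-shell Hilbert series (as a meromorphic function in $x$) is given by $$\operatorname{Hilb}_A^{\mathrm{on}}(x)=\lim_{C\to A}\ \sum_{i=1}^n\ \sum_{\zeta^{a_i}=1}\ \frac{1}{c_i\prod_{j=1,\,j\neq i}^n\bigl(1-\zeta^{a_j}x^{(c_i+c_j)/c_i}\bigr)\bigl(1-\zeta^{-a_j}x^{(c_i-c_j)/c_i}\bigr)}.$$ Here $C=(c_1,\ldots,c_n)\in\mathbb{R}^n$ is assumed to be such that $|c_i|\neq|c_j|$ for $i\neq j$, and the inner sum runs over all complex $\zeta$ with $\zeta^{a_i}=1$.
   Context: The circle $\mathbb{S}^1$ acts on $V=\mathbb{C}^n$ by $t\cdot(z_1,\ldots,z_n)=(t^{a_1}z_1,\ldots,t^{a_n}z_n)$. $\mathbb{R}[V]$ is the $\mathbb{R}$-algebra of real polynomial functions on the real vector space underlying $V$, graded by polynomial degree, and $\mathbb{R}[V]^{\mathbb{S}^1}$ is its subalgebra of invariants. The moment map is $J=\frac12\sum_{j=1}^n a_jz_j\overline{z_j}\in\mathbb{R}[V]^{\mathbb{S}^1}$; $I_J\subset\mathbb{R}[V]$ is the ideal generated by $J$, and $I_J^{\mathbb{S}^1}=I_J\cap\mathbb{R}[V]^{\mathbb{S}^1}$. The on-shell Hilbert series is $\operatorname{Hilb}_A^{\mathrm{on}}(x)=\sum_{i\ge0}\dim_{\mathbb{R}}\bigl(\mathbb{R}[V]^{\mathbb{S}^1}/I_J^{\mathbb{S}^1}\bigr)_i\,x^i$,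 the Hilbert series of the graded algebra $\mathbb{R}[V]^{\mathbb{S}^1}/I_J^{\mathbb{S}^1}$; it is the power series expansion at $0$ of a rational function, with which it is identified. Throughout $x\neq0$, and the real powers $x^{s}$ are defined by fixing a branch of the logarithm in a neighborhood of $x$.
   Formalization: The formula is proved as stated when all weights are positive; for general nonzero A the i-th summand is multiplied by sgn(a_i), dropping those with a_i = 0 (infinite inner sum). Unmodified it fails: for n = 1, A = (-1) it gives -1 instead of 1. *)

(* Defs.v *)
From HB Require Import structures.
From mathcomp Require Import all_boot all_order all_algebra.
From mathcomp Require Import all_classical all_reals all_analysis.
From mathcomp Require Import complex.
(* The notations of mpoly clash with those of mathcomp-analysis. *)
From mathcomp Require mpoly.
Import -(notations) mpoly.

Set Implicit Arguments.
Unset Strict Implicit.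
Unset Printing Implicit Defensive.

Import Order.TTheory GRing.Theory Num.Theory.
Import numFieldNormedType.Exports.
Local Open Scope classical_set_scope.
Local Open Scope ring_scope.
Local Open Scope complex_scope.

(* R[V] for V = C^n, written with z_j = X_j + i Y_j: X_j is the variable of
   index lshift n j and Y_j the variable of index rshift n j.  As R is infinite,
   a real polynomial function on V is the same thing as such a polynomial. *)
Definition realPoly (R : realType) (n : nat) := mpoly (n + n) R.

Definition real_coords (R : realType) (n : nat) (z : 'rV[R[i]]_n) :
    'I_(n + n) -> R :=
  fun k => match fintype.split k with
           | inl j => complex.Re (z 0 j)
           | inr j => complex.Im (z 0 j)
           end.

Definition circle_act (R : realType) (n : nat) (A : 'rV[int]_n) (t : R[i])
    (z : 'rV[R[i]]_n) : 'rV[R[i]]_n :=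
  \row_j (t ^ (A 0 j) * z 0 j).

Definition invariant (R : realType) (n : nat) (A : 'rV[int]_n)
    (p : realPoly R n) : Prop :=
  forall (t : R[i]) (z : 'rV[R[i]]_n), `|t| = 1 ->
    meval (real_coords (circle_act A t z)) p = meval (real_coords z) p.

(* z_j * conj z_j = X_j ^ 2 + Y_j ^ 2 *)
Definition moment_map (R : realType) (n : nat) (A : 'rV[int]_n) : realPoly R n :=
  (2^-1 : R) *: \sum_(j < n) ((A 0 j)%:~R : R) *:
    (mpolyX R (mnm1 (lshift n j)) ^+ 2 + mpolyX R (mnm1 (rshift n j)) ^+ 2).

Definition moment_ideal (R : realType) (n : nat) (A : 'rV[int]_n)
    (p : realPoly R n) : Prop :=
  exists q : realPoly R n, p = q * moment_map R A.

Definition invariant_of_degree (R : realType) (n : nat) (A : 'rV[int]_n) (d : nat)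
    (p : realPoly R n) : Prop :=
  invariant A p /\ p \is ishomog1 d mdeg.

(* k is the dimension of the degree d component of the quotient of the invariants
   by the invariant part of the moment ideal: the classes of some e_0, ..., e_(k-1)
   form a basis.  The difference below is automatically invariant, so its
   membership in the moment ideal is membership in the invariant part. *)
Definition onshell_dim (R : realType) (n : nat) (A : 'rV[int]_n) (d k : nat) : Prop :=
  exists e : 'I_k -> realPoly R n,
    (forall i, invariant_of_degree A d (e i)) /\
    (forall p, invariant_of_degree A d p ->
       exists! c : 'rV[R]_k, moment_ideal A (p - \sum_(i < k) c 0 i *: e i)).

Definition onshell_hilb (R : realType) (n : nat) (A : 'rV[int]_n) (d : nat) : nat :=
  xget 0%N [set k | @onshell_dim R n A d k].

(* The power series expansion at 0 of p / q is the series with coefficients h. *)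
Definition expansion_at0 (K : fieldType) (h : nat -> nat) (p q : {poly K}) : Prop :=
  q`_0 != 0 /\
  forall d : nat, \sum_(i < d.+1) q`_i * (h (d - i)%N)%:R = p`_d.

Definition cexp (R : realType) (z : R[i]) : R[i] :=
  (expR (complex.Re z))%:C * (cos (complex.Im z) +i* sin (complex.Im z)).

(* x ^ s for the branch of the logarithm whose value at x is L *)
Definition real_pow (R : realType) (L : R[i]) (s : R) : R[i] := cexp (L * s%:C).

(* The i-th summand, i.e. the inner sum over the zeta with zeta ^ a_i = 1.  The
   index set is finite exactly when a_i != 0.  For a_i < 0 the prefactor 1 / c_i is
   the opposite of the residue 1 / |c_i| that contributes to the Hilbert series (for
   n = 1 and A = (-1) the series is 1 and the summand tends to -1), so the sum of
   these terms must be weighted by sgz a_i when negative weights are allowed. *)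
Definition root_sum (R : realType) (n : nat) (A : 'rV[int]_n) (L : R[i])
    (C : 'rV[R]_n) (i : 'I_n) : R[i] :=
  \sum_(zeta \in [set zeta : R[i] | zeta ^ (A 0 i) = 1])
    1 / ((C 0 i)%:C *
         \prod_(j < n | j != i)
           ((1 - zeta ^ (A 0 j) * real_pow L ((C 0 i + C 0 j) / C 0 i)) *
            (1 - zeta ^ (- A 0 j) * real_pow L ((C 0 i - C 0 j) / C 0 i)))).

Definition generic (R : realType) (n : nat) : set 'rV[R]_n :=
  [set C | forall i j : 'I_n, i != j -> `|C 0 i| != `|C 0 j|].

(* lim_(C -> A) F C = l, with C restricted to the generic vectors *)
Definition generic_limit (R : realType) (n : nat) (A : 'rV[int]_n)
    (F : 'rV[R]_n -> R[i]) (l : R[i]) : Prop :=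
  F @ within (@generic R n) (nbhs (map_mx (fun a : int => a%:~R : R) A))
    --> (l : (R[i])^o).

(* Main.v *)
(** After complexification the invariants of degree d are spanned by the monomials
    in z_j and its conjugate whose S^1-weight is 0.  Multiplication by J is injective
    and an invariant multiple q * J forces q to be invariant, so the on-shell Hilbert
    series is (1 - x^2) times the generating function of these monomials, i.e. times
    the constant term in T of \prod_i 1 / (1 - x T^(w_i)) for the 2n weights w = (A, -A).
    Replacing the factor i by 1 - x o^i T^(w_i) separates the poles; partial fractions
    in T then express the constant term as the sum of the residues at the poles of the
    factors of negative weight, and o = 1 gives the Hilbert series.

    The generic vector C deforms the residues in another way.  In both deformations
    the poles that collide in the limit form clusters, and the residues of a cluster
    sum to a divided difference of a product of exponentials and of their difference
    quotients.  By the mean value theorem for divided differences it has a limit that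
    depends only on the limits of the parameters.  Hence the limit over C -> A exists
    and may be computed along the first deformation. *)

Require Import Defs.
From HB Require Import structures.
From mathcomp Require Import all_boot all_order all_algebra.
From mathcomp Require Import all_classical all_reals all_analysis.
From mathcomp Require Import complex cyclic separable cyclotomic.
From mathcomp Require Import ring lra zify.
From mathcomp Require mpoly.
Import -(notations) mpoly.

Set Implicit Arguments.
Unset Strict Implicit.
Unset Printing Implicit Defensive.

Import Order.TTheory GRing.Theory Num.Theory.
Local Open Scope ring_scope.

(** * Partial fractions and lattice point counting *)

(** For [C] away from [A] the root sum is not a residue sum of a rational function of T: the
    exponents c_j are real and T^(c_j) only stands for a chosen value, so partial fractions say
    nothing about it. The deformation by powers of o keeps the weights integral and hence stays
    algebraic, but it does not contain the vectors [C]. Both are therefore placed under one filter,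
    on pairs (c, d) where c perturbs the weights and d the exponents of x; existence of the limit is
    proved for the whole filter and its value is read off on one path. Only factors of equal
    negative weight collide, and only at the same root of unity, as long as x^m differs from 1 for
    all positive m up to twice the sum of the 2n absolute weights. This bound is the origin of the
    finite exceptional set. The weights (A, -A) give each index a partner of opposite weight. At a
    pole of one of them the partner's factor is 1 - x^2, which cancels the factor contributed by J.
    According to the sign of a_i the pole belongs to one or the other member of the pair, and this
    produces the sign in front of the i-th root sum. *)

Lemma comax_prod (T : comNzRingType) (I J : finType) (P : pred I) (Q : pred J)
    (u : J -> T) (d : I -> T) (r : J -> I -> T) :
  (forall i j, P i -> Q j -> exists b c, u j * b + d i * c = r j i) ->
  exists b c, (\prod_(j | Q j) u j) * b + (\prod_(i | P i) d i) * c =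
    \prod_(j | Q j) \prod_(i | P i) r j i.
Proof.
move=> h.
have hj j : Q j -> exists b c, u j * b + (\prod_(i | P i) d i) * c =
    \prod_(i | P i) r j i.
  move=> Qj; elim/big_rec2: _ => [|i r' D Pi [b [c e]]].
    by exists 0, 1; rewrite mulr0 add0r mulr1.
  have [b' [c' e']] := h i j Pi Qj.
  exists (b * (u j * b' + d i * c') + D * c * b'), (c' * c).
  by rewrite -e -e'; ring.
elim/big_rec2: _ => [|j r' U Qj [b [c e]]].
  by exists 1, 0; rewrite mulr0 addr0 mulr1.
have [b' [c' e']] := hj j Qj.
set D := \prod_(i | _) d i in e e' *.
exists (b * b'), (U * b * c' + c * u j * b' + D * c * c').
by rewrite -e -e'; ring.
Qed.

Lemma mul1_sub_geom (A : nzRingType) (s : A) n :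
  (1 - s) * (\sum_(k < n) s ^+ k) = 1 - s ^+ n.
Proof. by rewrite -[1 - s]opprB -[1 - _ ^+ _]opprB mulNr -subrX1. Qed.

(** Lagrange interpolation: each [Dr r] is monic of degree [(size rs).-1], so the top coefficient is
    the sum of the interpolation weights. It serves twice, for sums of residues and for the
    symmetric form of divided differences. *)
Lemma lagrange_lead (K : fieldType) (rs : seq K) (P : {poly K}) :
  uniq rs -> (0 < size rs)%N -> (size P <= size rs)%N ->
  P`_(size rs).-1 =
    \sum_(r <- rs) P.[r] / (\prod_(r <- rs) ('X - r%:P))^`().[r].
Proof.
move=> urs rs0 sP; set D := \prod_(r <- rs) _.
pose Dr r := \prod_(s <- rem r rs) ('X - s%:P).
have DE r : r \in rs -> D = ('X - r%:P) * Dr r.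
  by move=> rrs; rewrite /D (perm_big _ (perm_to_rem rrs)) big_cons.
have dE r : r \in rs -> D^`().[r] = (Dr r).[r].
  move=> rrs; rewrite (DE r rrs) derivM derivXsubC mul1r.
  by rewrite !hornerE subrr mul0r addr0.
have Dnz r : r \in rs -> (Dr r).[r] != 0.
  by move=> rrs; rewrite -/(root _ _) root_prod_XsubC mem_rem_uniq // inE eqxx.
have D0 r s : r \in rs -> s \in rs -> s != r -> (Dr r).[s] = 0.
  move=> rrs srs sr; apply/rootP; rewrite root_prod_XsubC mem_rem_uniq //.
  by rewrite !inE sr.
have sD r : r \in rs -> size (Dr r) = size rs.
  by move=> rrs; rewrite size_prod_XsubC size_rem // prednK.
pose L := \sum_(r <- rs) (P.[r] / D^`().[r]) *: Dr r.
have PL : P = L.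
  apply/eqP; rewrite -subr_eq0; apply: contraT => nz.
  suff: (size rs < size (P - L)%R)%N.
    rewrite ltnNge => /negP[].
    apply: leq_trans (size_polyD _ _) _; rewrite size_polyN geq_max sP /=.
    apply: leq_trans (size_sum _ _ _) _; rewrite big_seq.
    apply/bigmax_leqP_seq => r rrs _; apply: leq_trans (size_scale_leq _ _) _.
    by rewrite sD.
  apply: max_poly_roots => //; apply/allP => r rrs; apply/rootP.
    rewrite !hornerE /L horner_sum (big_rem r) //= !hornerE dE // divfK ?Dnz //.
    rewrite big_seq big1 ?addr0 ?subrr // => s.
    rewrite mem_rem_uniq // !inE => /andP[sr srs].
    by rewrite !hornerE (D0 s r) ?mulr0 // eq_sym.
rewrite {1}PL /L coef_sum big_seq [RHS]big_seq; apply: eq_bigr => r rrs.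
rewrite coefZ; have /monicP : Dr r \is monic by apply: monic_prod_XsubC.
by rewrite lead_coefE sD // => ->; rewrite mulr1.
Qed.

Section Weights.
Variables (N : nat) (w : 'I_N -> int).

Definition negw : pred 'I_N := fun i => w i < 0.
(** Weight 0 is put with the positive ones: its factor is constant in T and has no pole. *)
Definition posw : pred 'I_N := fun i => ~~ (w i < 0).
Definition tdeg : nat := \sum_(i | negw i) `|w i|%N.

Lemma negw_absz_gt0 i : negw i -> (0 < `|w i|)%N.
Proof. by rewrite absz_gt0 /negw => /ltr0_neq0. Qed.

Section Ring.
Variables (T : comNzRingType) (y : 'I_N -> T).

(* \prod_i 1 / (1 - y_i T^(w_i)) = T^tdeg / (upoly * dpoly) *)
Definition dpoly : {poly T} := \prod_(i | negw i) ('X^`|w i|%N - (y i)%:P).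
Definition upoly : {poly T} := \prod_(j | posw j) (1 - (y j)%:P * 'X^`|w j|%N).
Definition qden : T :=
  \prod_(j | posw j) \prod_(i | negw i) (1 - y j ^+ `|w i|%N * y i ^+ `|w j|%N).

(** Where T^a = y_i and y_j T^b = 1 one has y_j^a y_i^b = (y_j T^b)^a = 1, so each factor of [qden]
    lies in the ideal of the corresponding pair. The certificate is explicit because the identity is
    used over polynomial rings, with x and o as indeterminates. *)
Lemma bezout_weights : exists B P : {poly T}, upoly * B + dpoly * P = qden%:P.
Proof.
have [|B [P e]] := @comax_prod {poly T} _ _ negw posw
  (fun j => 1 - (y j)%:P * 'X^`|w j|%N) (fun i => 'X^`|w i|%N - (y i)%:P)
  (fun j i => (1 - y j ^+ `|w i|%N * y i ^+ `|w j|%N)%:P).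
  move=> i j _ _; set a := `|w i|%N; set b := `|w j|%N.
  (* The first geometric sum turns 1 - y_j T^b into 1 - y_j^a T^(ab), the second turns T^a - y_i
     into T^(ab) - y_i^b. *)
  exists (\sum_(k < a) ((y j)%:P * 'X^b) ^+ k).
  exists ((y j ^+ a)%:P * \sum_(k < b) 'X^a ^+ (b.-1 - k) * (y i)%:P ^+ k).
  rewrite mul1_sub_geom mulrCA.
  have -> : ('X^a - (y i)%:P) * (\sum_(k < b) 'X^a ^+ (b.-1 - k) * (y i)%:P ^+ k)
     = 'X^a ^+ b - (y i)%:P ^+ b.
    by rewrite subrXX.
  rewrite exprMn -!exprM mulnC rmorphB rmorphM !rmorphXn /=; ring.
exists B, P; rewrite e /qden rmorph_prod; apply: eq_bigr => j _.
by rewrite rmorph_prod.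
Qed.

Lemma dpoly_monic : dpoly \is monic.
Proof.
by apply: monic_prod => i wi; rewrite monicXnsubC ?negw_absz_gt0.
Qed.

Lemma size_dpoly : size dpoly = tdeg.+1.
Proof.
suff: dpoly \is monic /\ size dpoly = tdeg.+1 by case.
rewrite /dpoly /tdeg; apply: (big_rec2 (fun (p : {poly T}) n => p \is monic /\ size p = n.+1))
  => [|i p n wi [mp sp]].
  by rewrite rpred1 size_poly1.
rewrite monicMl ?monicXnsubC ?negw_absz_gt0 //.
rewrite size_Mmonic ?monic_neq0 ?monicXnsubC ?negw_absz_gt0 //; split=> //.
by rewrite size_XnsubC ?negw_absz_gt0 // sp addnS addSn.
Qed.

(** Writing U, D for [upoly], [dpoly], the identity U B + D P = q makes T^tdeg / (U D) equal to (Q +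
    R / D + T^tdeg P / U) / q. Expanded in 1/T, the proper fraction R / D has only negative powers,
    and the last term has only powers from [tdeg] on; the constant term is thus that of Q, divided
    by q. *)
Lemma dpoly_division (B : {poly T}) : exists Q R : {poly T},
  'X^tdeg * B = dpoly * Q + R /\ (size R <= tdeg)%N.
Proof.
exists (Pdiv.Ring.rdivp ('X^tdeg * B) dpoly), (Pdiv.Ring.rmodp ('X^tdeg * B) dpoly).
rewrite [dpoly * _]mulrC -Pdiv.RingMonic.rdivp_eq ?dpoly_monic //; split=> //.
by rewrite -ltnS -size_dpoly; apply: Pdiv.Ring.ltn_rmodpN0; rewrite monic_neq0 ?dpoly_monic.
Qed.

End Ring.

Section Expansion.
Variable T : comNzRingType.
Implicit Types (M d : nat).

Definition wdeg (M : nat) (f : {ffun 'I_N -> 'I_M}) : nat := \sum_i f i.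
Definition wweight (M : nat) (f : {ffun 'I_N -> 'I_M}) : int :=
  \sum_i w i * (f i : nat)%:Z.
(** For d < M the bound on the exponents excludes nothing, so all monomials of degree d and weight 0
    are counted. *)
Definition wcount M d : nat :=
  #|[set f : {ffun 'I_N -> 'I_M} | (wdeg f == d) && (wweight f == 0)]|.

Lemma prod_subrX (A : comNzRingType) (I : finType) (P : pred I) (u : I -> A) (e : A) :
  exists Y, \prod_(i | P i) (u i - e) = \prod_(i | P i) u i + e * Y.
Proof.
apply: (big_rec2 (fun a b => exists Y, a = b + e * Y)) => [|i a b Pi [Y ->]].
  by exists 0; rewrite mulr0 addr0.
by exists (u i * Y - b - e * Y); ring.
Qed.

Local Notation x := ('X : {poly T}).

(** Geometric series in x T^(w_i) truncated at order M, each multiplied by T^(|w_i| (M - 1)) to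
    clear negative powers. In the product with [utrunc] the constant term in T therefore sits at
    exponent [tdeg * M.-1]. *)
Definition dtrunc M : {poly {poly T}} :=
  \prod_(i | negw i) \sum_(l < M) (x ^+ l)%:P * 'X^(`|w i| * (M.-1 - l))%N.
Definition utrunc M : {poly {poly T}} :=
  \prod_(i | posw i) \sum_(k < M) (x ^+ k)%:P * 'X^(`|w i| * k)%N.

Lemma dpoly_dtrunc M : (0 < M)%N -> exists Y,
  dpoly (fun=> x) * dtrunc M = 'X^(tdeg * M) + (x ^+ M)%:P * Y.
Proof.
move=> M0.
have [Y e] := @prod_subrX {poly {poly T}} _ negw (fun i => 'X^(`|w i| * M)%N) (x ^+ M)%:P.
exists Y; rewrite -(_ : \prod_(i | negw i) 'X^(`|w i| * M)%N = 'X^(tdeg * M)); last first.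
  by rewrite -expr_sum big_distrl.
rewrite -e -big_split /=; apply: eq_bigr => i wi.
rewrite exprM rmorphXn /= subrXX; congr (_ * _); apply: eq_bigr => l _.
by rewrite rmorphXn /= mulrC exprM.
Qed.

Lemma upoly_utrunc M : (0 < M)%N -> exists Y,
  upoly (fun=> x) * utrunc M = 1 + (x ^+ M)%:P * Y.
Proof.
move=> M0; rewrite -big_split /=.
apply: (big_ind (fun a => exists Y, a = 1 + (x ^+ M)%:P * Y)).
- by exists 0; rewrite mulr0 addr0.
- move=> a b [Y ->] [Z ->]; exists (Y + Z + (x ^+ M)%:P * Y * Z); ring.
move=> i _; exists (- 'X^(`|w i| * M)%N).
rewrite mulrN rmorphXn /= exprM -exprMn -mul1_sub_geom.
congr (_ * _); apply: eq_bigr => k _.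
by rewrite exprMn -exprM rmorphXn.
Qed.

Lemma size_dtrunc M : (0 < M)%N -> (size (dtrunc M) <= (tdeg * M.-1).+1)%N.
Proof.
move=> M0; rewrite /dtrunc /tdeg big_distrl /=.
apply: (big_rec2 (fun (p : {poly {poly T}}) n => (size p <= n.+1)%N)) => [|i p n wi h].
  by rewrite size_poly1.
apply: leq_trans (size_polyMleq _ _) _.
have hs : (size (\sum_(l < M) (x ^+ l)%:P * 'X^(`|w i| * (M.-1 - l))%N : {poly {poly T}})%R
   <= (`|w i| * M.-1).+1)%N.
  apply: leq_trans (size_sum _ _ _) _; apply/bigmax_leqP => l _.
  rewrite mul_polyC; apply: leq_trans (size_scale_leq _ _) _.
  by rewrite size_polyXn ltnS leq_mul2l leq_subr orbT.
by rewrite -subn1 leq_subLR; apply: leq_trans (leq_add hs h) _; rewrite addnS addSn addnC add1n.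
Qed.

Lemma coef_utrunc_dtrunc M d : (d < M)%N ->
  (utrunc M * dtrunc M)`_(tdeg * M.-1)`_d = (wcount M d)%:R.
Proof.
move=> dM.
pose e (i : 'I_N) (k : 'I_M) := (`|w i| * (if negw i then M.-1 - k else k))%N.
have -> : utrunc M * dtrunc M =
    \prod_i \sum_(k < M) (x ^+ k)%:P * 'X^(e i k).
  rewrite [RHS](bigID negw) /= mulrC; congr (_ * _); apply: eq_bigr => i wi.
    by apply: eq_bigr => k _; rewrite /e wi.
  by apply: eq_bigr => k _; rewrite /e /negw (negbTE wi).
rewrite bigA_distr_bigA /= coef_sum coef_sum /wcount -sum1_card natr_sum.
rewrite [RHS]big_mkcond /=; apply: eq_bigr => f _; rewrite inE.
rewrite big_split /= -rmorph_prod /= coefCM -expr_sum -expr_sum coefXn.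
rewrite -/(wdeg f).
rewrite mulr_natr coefMn coefXn.
rewrite (_ : (tdeg * M.-1 == \sum_i e i (f i))%N = (wweight f == 0)); last first.
  rewrite eq_sym -eqz_nat -subr_eq0; congr (_ == 0).
  rewrite /tdeg big_distrl /= -!natz !natr_sum [X in _ - X]big_mkcond /= -sumrB.
  apply: eq_bigr => i _; rewrite !natz /e /negw.
  have := ltn_ord (f i); case: ltrP => wi fM; last by rewrite subr0 PoszM gez0_abs.
  have le : (f i <= M.-1)%N by lia.
  rewrite mulnBr -subzn ?leq_mul2l ?le ?orbT // addrAC subrr add0r PoszM ltz0_abs //.
  by rewrite mulNr opprK.
by rewrite [d == _]eq_sym; case: (wdeg f == d); case: (wweight f == 0).
Qed.

(* Q`_0 / q is the constant term in T of \prod_i 1 / (1 - x T^(w_i)), here compared with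
   the product of geometric sums truncated at order M. *)
Lemma formal_expansion (B P Q R : {poly {poly T}}) (q : {poly T}) :
  (0 < tdeg)%N ->
  upoly (fun=> x) * B + dpoly (fun=> x) * P = q%:P ->
  'X^tdeg * B = dpoly (fun=> x) * Q + R -> (size R <= tdeg)%N ->
  forall M, (0 < M)%N -> exists e : {poly T},
   Q`_0 = q * (utrunc M * dtrunc M)`_(tdeg * M.-1) + 'X^M * e.
Proof.
move=> d0 hU hD hR M M0.
have [Y1 e1] := dpoly_dtrunc M0; have [Y2 e2] := upoly_utrunc M0.
set D := dpoly _ in hU hD e1; set U := upoly _ in hU e2.
set S := dtrunc M in e1 *; set V := utrunc M in e2 *.
set c := (x ^+ M)%:P in e1 e2.
(* This is Q + R / D + T^tdeg P / U = q T^tdeg / (U D), multiplied by T^(tdeg M), with 1 / D and 1 /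
   U replaced by their truncations up to a multiple of x^M. *)
have E : 'X^(tdeg * M) * Q + R * S = q%:P * ('X^tdeg * (V * S))
   - 'X^(tdeg + tdeg * M) * (P * V) - c * ('X^tdeg * Y1 * P * V + 'X^tdeg * B * S * Y2
    + Y1 * Q).
  rewrite exprD; apply/eqP; rewrite -subr_eq0; apply/eqP.
  transitivity ('X^tdeg * S * V * (U * B + D * P - q%:P)
    - S * ('X^tdeg * B - (D * Q + R))
    - (Q + 'X^tdeg * P * V) * (D * S - ('X^(tdeg * M) + c * Y1))
    - 'X^tdeg * S * B * (U * V - (1 + c * Y2))); first by ring.
  by rewrite hU hD e1 e2 !subrr !mulr0 !subr0.
have tM : (tdeg * M = tdeg * M.-1 + tdeg)%N by rewrite -mulnSr prednK.
have := congr1 (fun p : {poly {poly T}} => p`_(tdeg * M)) E.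
have lt1 : (tdeg * M < tdeg)%N = false by rewrite ltnNge tM leq_addl.
have lt2 : (tdeg * M < tdeg + tdeg * M)%N by rewrite -[X in (X < _)%N]add0n ltn_add2r.
(* At exponent [tdeg * M] the term with [P * V] drops out because [tdeg] is positive, and [R * S]
   because its degree is smaller. *)
rewrite !coefB !coefD !coefCM !coefXnM ltnn subnn lt1 lt2.
rewrite [(R * S)`_ _]nth_default; last first.
  apply: leq_trans (size_polyMleq _ _) _; rewrite -subn1 leq_subLR.
  apply: leq_trans (leq_add hR (size_dtrunc M0)) _.
  by rewrite tM addnS addnC add1n.
rewrite addr0 subr0 tM addnK => ->; rewrite -mulrN; by eexists.
Qed.

End Expansion.

Section NumericResidues.
Variables (K : fieldType) (y e z : 'I_N -> K).
Hypothesis prim_z : forall i, negw i -> (`|w i|%N).-primitive_root (z i).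
Hypothesis e_neq0 : forall i, negw i -> e i != 0.
Hypothesis e_root : forall i, negw i -> e i ^+ `|w i|%N = y i.
Hypothesis nodes_inj : forall i i' k k', negw i -> negw i' ->
  z i ^+ k * e i = z i' ^+ k' * e i' -> i = i'.

Let rs := [seq z i ^+ k * e i | i <- enum negw, k <- iota 0 `|w i|].

Lemma uniq_nodes : uniq rs.
Proof.
apply: allpairs_uniq_dep; [exact: enum_uniq|by move=> i _; exact: iota_uniq|].
move=> [i k] [i' k'] /allpairsPdep[i1 [k1 [i1n k1n [-> ->]]]].
move=> /allpairsPdep[i2 [k2 [i2n k2n [-> ->]]]] /=.
move: i1n i2n k1n k2n; rewrite !mem_enum !mem_iota /= !add0n => n1 n2 l1 l2 eq12.
have i12 := nodes_inj n1 n2 eq12; rewrite -{}i12 in n2 l2 eq12 *.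
move/(mulIf (e_neq0 n1))/eqP: eq12.
by rewrite (eq_prim_root_expr (prim_z n1)) !modn_small // => /eqP ->.
Qed.

Lemma size_nodes : size rs = tdeg.
Proof.
rewrite size_allpairs_dep /tdeg -big_enum /= sumnE big_map.
by apply: eq_bigr => i _; rewrite size_iota.
Qed.

Lemma dpoly_roots : dpoly y = \prod_(r <- rs) ('X - r%:P).
Proof.
rewrite [LHS](@all_roots_prod_XsubC _ _ rs) ?size_dpoly ?size_nodes //.
- by rewrite (monicP (dpoly_monic y)) scale1r.
- apply/allP => _ /allpairsPdep[i [k [+ _ ->]]]; rewrite mem_enum => wi.
  apply/rootP; rewrite /dpoly horner_prod (bigD1 i) //= !hornerE.
  rewrite exprMn exprAC (prim_expr_order (prim_z wi)) expr1n mul1r.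
  by rewrite e_root // subrr mul0r.
by rewrite uniq_rootsE uniq_nodes.
Qed.

(** With r = z_i^k e_i, the summand is the residue at T = r of 1/T times the product of the 1 / (1 -
    y_j T^(w_j)). *)
Lemma residue_sum (B P Q R : {poly K}) (q : K) :
  (0 < tdeg)%N -> q != 0 ->
  upoly y * B + dpoly y * P = q%:P ->
  'X^tdeg * B = dpoly y * Q + R -> (size R <= tdeg)%N ->
  Q`_0 / q = \sum_(i | negw i) \sum_(k < `|w i|%N)
    1 / ((`|w i|%N)%:R * \prod_(j | j != i) (1 - y j * (z i ^+ k * e i) ^ (w j))).
Proof.
move=> d0 q0 hU hD hR.
have szrs := size_nodes.
(* Its degree is below [tdeg], its top coefficient is Q(0) since T R1 = D Q(0) + R with D monic, and
   at the roots of D it takes the values of T^(tdeg - 1) B; Lagrange interpolation then applies. *)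
pose R1 := 'X^(tdeg.-1) * B - dpoly y * (Q %/ 'X).
have QE : Q = (Q %/ 'X) * 'X + (Q`_0)%:P.
  rewrite {1}(divp_eq Q 'X); congr (_ + _).
  by rewrite -[X in _ %% X]subr0 -[X in 'X - X]polyC0 modp_XsubC horner_coef0.
have R1E : 'X * R1 = dpoly y * (Q`_0)%:P + R.
  rewrite /R1 mulrBr mulrA -exprS prednK // hD {1}QE; ring.
have lR1 : R1`_(size rs).-1 = Q`_0.
  have := congr1 (fun p : {poly K} => p`_tdeg) R1E; rewrite coefXM szrs eqn0Ngt d0 /= => ->.
  rewrite coefD coefMC [R`__]nth_default // addr0.
  by have /monicP := dpoly_monic y; rewrite lead_coefE size_dpoly => ->; rewrite mul1r.
have sR1 : (size R1 <= size rs)%N.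
  rewrite szrs; have [->|nz] := eqVneq R1 0; first by rewrite size_poly0.
  rewrite -ltnS -(size_mulX nz) mulrC R1E.
  apply: leq_trans (size_polyD _ _) _; rewrite geq_max (leq_trans hR) // andbT.
  by rewrite mulrC mul_polyC (leq_trans (size_scale_leq _ _)) // size_dpoly.
rewrite -lR1 lagrange_lead ?uniq_nodes //; last by rewrite szrs.
rewrite -dpoly_roots mulr_suml big_allpairs_dep big_enum_cond /=.
apply: eq_big => [i|i /andP[wi _]]; first by rewrite andbT.
rewrite -[X in iota 0 X]subn0 -/(index_iota 0 _) big_mkord; apply: eq_bigr => k _.
set r := _ * e i.
have {}wi : negw i := wi.
have a0 := negw_absz_gt0 wi.
have r0 : r != 0.
  by rewrite mulf_neq0 ?e_neq0 // expf_neq0 // (prim_root_eq0 (prim_z wi)) -lt0n.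
have rw : r ^+ `|w i|%N = y i.
  by rewrite exprMn exprAC (prim_expr_order (prim_z wi)) expr1n mul1r e_root.
have DE : dpoly y = ('X^`|w i|%N - (y i)%:P) *
    \prod_(j | negw j && (j != i)) ('X^`|w j|%N - (y j)%:P).
  by rewrite /dpoly (bigD1 i).
have Dr : (dpoly y).[r] = 0 by rewrite DE !hornerE rw subrr mul0r.
have Ur : (upoly y).[r] * B.[r] = q.
  by have := congr1 (fun p : {poly K} => p.[r]) hU; rewrite !hornerE Dr mul0r addr0.
have -> : R1.[r] = r ^+ (tdeg.-1) * B.[r] by rewrite /R1 !hornerE Dr mul0r subr0.
have -> : (dpoly y)^`().[r] = (`|w i|%N)%:R * r ^+ (`|w i|.-1)%N *
   \prod_(j | negw j && (j != i)) (r ^+ `|w j|%N - y j).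
  rewrite DE derivM !hornerE rw subrr mul0r addr0 derivB derivC subr0 derivXn.
  rewrite hornerMn hornerXn horner_prod mulr_natl; congr (_ * _).
  by apply: eq_bigr => j _; rewrite !hornerE.
(* For a negative weight the factor is (r^|w_j| - y_j) / r^|w_j|, and the denominators collect to
   r^(tdeg - |w_i|). *)
have -> : \prod_(j | j != i) (1 - y j * r ^ w j) = (upoly y).[r] *
    ((\prod_(j | negw j && (j != i)) (r ^+ `|w j|%N - y j)) / r ^+ (tdeg - `|w i|)).
  rewrite (bigID negw) /= mulrC; congr (_ * _).
    rewrite /upoly horner_prod; apply: eq_big => [j|j /andP[ji wj]].
      by rewrite /posw -/(negw j); case: eqP => //= ->; rewrite wi.
    rewrite !hornerE; congr (1 - _ * _).
    by rewrite exprnP gez0_abs // leNgt.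
  have -> : (tdeg - `|w i| = \sum_(j | negw j && (j != i)) `|w j|)%N.
    by rewrite /tdeg (bigD1 i) //= addKn.
  rewrite expr_sum -prodf_div.
  apply: eq_big => [j|j /andP[ji wj]]; first by rewrite andbC.
  rewrite mulrBl divff ?expf_neq0 //; congr (1 - _ * _).
  by rewrite exprnN ltz0_abs // opprK.
have dE : (tdeg.-1 = `|w i|.-1 + (tdeg - `|w i|))%N.
  have : (`|w i| <= tdeg)%N by rewrite /tdeg (bigD1 i) //= leq_addr.
  by lia.
have [U0 B0] : (upoly y).[r] != 0 /\ B.[r] != 0.
  by apply/andP; rewrite -negb_or -mulf_eq0 Ur.
rewrite dE exprD -Ur; set p := \prod_(j | _) _.
rewrite !invfM !invrK.
transitivity ((r ^+ (`|w i|.-1)%N / r ^+ (`|w i|.-1)%N) * (B.[r] / B.[r]) * r ^+ (tdeg - `|w i|) *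
  ((`|w i|%N)%:R)^-1 * (upoly y).[r]^-1 * p^-1); first by ring.
by rewrite !divff ?expf_neq0 //; ring.
Qed.

End NumericResidues.
End Weights.

Section WeightMorphism.
Variables (N : nat) (w : 'I_N -> int).
Variables (S T : comNzRingType) (f : {rmorphism S -> T}) (y : 'I_N -> S) (y' : 'I_N -> T).
Hypothesis fy : forall i, f (y i) = y' i.

Lemma map_dpoly : map_poly f (dpoly w y) = dpoly w y'.
Proof.
rewrite rmorph_prod; apply: eq_bigr => i _.
by rewrite rmorphB /= map_polyXn map_polyC -fy.
Qed.

Lemma map_upoly : map_poly f (upoly w y) = upoly w y'.
Proof.
rewrite rmorph_prod; apply: eq_bigr => i _.
by rewrite rmorphB rmorph1 rmorphM /= map_polyXn map_polyC -fy.
Qed.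

Lemma map_qden : f (qden w y) = qden w y'.
Proof.
rewrite rmorph_prod; apply: eq_bigr => j _; rewrite rmorph_prod.
by apply: eq_bigr => i _; rewrite rmorphB rmorph1 rmorphM !rmorphXn !fy.
Qed.

Lemma map_bezout_division (B P Q U : {poly S}) :
  upoly w y * B + dpoly w y * P = (qden w y)%:P ->
  'X^(tdeg w) * B = dpoly w y * Q + U -> (size U <= tdeg w)%N ->
  [/\ upoly w y' * map_poly f B + dpoly w y' * map_poly f P = (qden w y')%:P,
   'X^(tdeg w) * map_poly f B = dpoly w y' * map_poly f Q + map_poly f U &
   (size (map_poly f U) <= tdeg w)%N].
Proof.
move=> hU hD hR; split.
- by rewrite -map_upoly -map_dpoly -map_qden -map_polyC -hU rmorphD !rmorphM.
- by rewrite -map_dpoly -(map_polyXn f) -!rmorphM hD rmorphD.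
apply: leq_trans hR; apply/leq_sizeP => i hi.
by rewrite coef_map /= (nth_default 0 hi) rmorph0.
Qed.

End WeightMorphism.

Section GeneratingFunction.
Variables (K : fieldType) (N : nat) (w : 'I_N -> int).

Definition qgen : {poly K} := qden w (fun=> 'X).

Lemma qgen_coef0 : qgen`_0 = 1.
Proof.
rewrite -horner_coef0 -[_.[0]]/(horner_eval 0 qgen) (@map_qden _ _ _ _ _ _ (fun=> 0)); last first.
  by move=> i; rewrite /= /horner_eval hornerX.
apply: big1 => j _; apply: big1 => i wi.
by rewrite expr0n gtn_eqF ?negw_absz_gt0 // mul0r subr0.
Qed.

Lemma horner_qgen x : qgen.[x] = qden w (fun=> x).
Proof.
by rewrite -[_.[x]]/(horner_eval x qgen); apply: map_qden => i; rewrite /= /horner_eval hornerX.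
Qed.

(* v is a polynomial in o with coefficients in K[x]; at o = 1 it is the numerator of the
   generating function, while the second part needs o to separate the poles. *)
Lemma generating_function : (0 < tdeg w)%N -> exists v : {poly {poly K}},
  (forall M d, (d < M)%N ->
     \sum_(i < d.+1) qgen`_i * (wcount w M (d - i))%:R = v.[1]`_d) /\
  (forall (x o : K) (e z : 'I_N -> K),
    let y (i : 'I_N) := x * o ^+ i in
    (forall i, negw w i -> (`|w i|%N).-primitive_root (z i)) ->
    (forall i, negw w i -> e i != 0) ->
    (forall i, negw w i -> e i ^+ `|w i|%N = y i) ->
    (forall i i' k k', negw w i -> negw w i' ->
       z i ^+ k * e i = z i' ^+ k' * e i' -> i = i') ->
    qden w y != 0 ->
    v.[o%:P].[x] / qden w y = \sum_(i | negw w i) \sum_(k < `|w i|%N)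
      1 / ((`|w i|%N)%:R * \prod_(j | j != i) (1 - y j * (z i ^+ k * e i) ^ (w j)))).
Proof.
move=> d0.
(* The outer variable is o, the inner one x. The Bezout identity and the division are carried out
   once over this ring and then specialised: to o = 1 with x formal for the series, and to numbers
   x, o for the residues. *)
pose Y (i : 'I_N) : {poly {poly K}} := 'X%:P * 'X^i.
have [B [P hU]] := bezout_weights w Y.
have [Q [R [hD hR]]] := dpoly_division w Y B.
exists Q`_0; split=> [M d dM|x o e z y hz he hy hinj hq].
- have fY i : horner_eval 1 (Y i) = 'X by rewrite /horner_eval !hornerE expr1n mulr1.
  have [hU' hD' hR'] := map_bezout_division fY hU hD hR.
  have M0 : (0 < M)%N by case: M dM.
  have [r] := formal_expansion d0 hU' hD' hR' M0.
  rewrite coef_map /= /horner_eval => ->.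
  rewrite coefD coefXnM dM addr0 coefM; apply: eq_bigr => i _.
  by rewrite coef_utrunc_dtrunc // (leq_ltn_trans (leq_subr _ _)).
have gY i : (horner_eval x \o horner_eval o%:P) (Y i) = y i.
  by rewrite /= /horner_eval !hornerE.
have [hU' hD' hR'] := map_bezout_division gY hU hD hR.
by rewrite -(residue_sum hz he hy hinj d0 hq hU' hD' hR') coef_map.
Qed.

End GeneratingFunction.

Import numFieldNormedType.Exports.
Local Open Scope classical_set_scope.
Local Open Scope ring_scope.
Local Open Scope complex_scope.

Local Notation Re := complex.Re.
Local Notation Im := complex.Im.
Local Notation cvgc F f l := (f @ F --> ((l : _[i]) : (_[i])^o)) (only parsing).

(** * Divided differences *)

Section DividedDifferences.
Variables (K : fieldType) (t : nat -> K).
Implicit Types (u v : nat -> K).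

Fixpoint dd u (i m : nat) : K :=
  if m is m'.+1 then (dd u i.+1 m' - dd u i m') / (t (i + m)%N - t i) else u i.

Arguments dd : simpl never.

Lemma dd0 u i : dd u i 0 = u i. Proof. by []. Qed.

Lemma ddS u i m :
  dd u i m.+1 = (dd u i.+1 m - dd u i m) / (t (i + m.+1)%N - t i).
Proof. by []. Qed.

Definition distinct_nodes (s : nat) :=
  forall i j, (i < s)%N -> (j < s)%N -> t i = t j -> i = j.

Variable s : nat.
Hypothesis t_inj : distinct_nodes s.

Let tnz i j : (i < j)%N -> (j < s)%N -> t j - t i != 0.
Proof.
move=> ij js; rewrite subr_eq0; apply/eqP => e.
by have := t_inj js (ltn_trans ij js) e; lia.
Qed.

(** Neville's recursion: the interpolants on two overlapping runs of nodes combine to one on their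
    union, and top coefficients then obey the recursion of [dd]. *)
Lemma neville u i m : (i + m < s)%N -> exists P : {poly K},
  [/\ (size P <= m.+1)%N, P`_m = dd u i m &
      forall k, (k <= m)%N -> P.[t (i + k)%N] = u (i + k)%N].
Proof.
elim: m i => [|m IH] i im.
  exists (u i)%:P; split; first exact: size_polyC_leq1.
    by rewrite coefC.
  by move=> k; rewrite leqn0 => /eqP ->; rewrite hornerC addn0.
have [P [sP lP hP]] := IH i ltac:(lia).
have [Q [sQ lQ hQ]] := IH i.+1 ltac:(lia).
have nz : t (i + m.+1)%N - t i != 0 by apply: tnz; lia.
exists ((t (i + m.+1)%N - t i)^-1 *:
  (('X - (t i)%:P) * Q - ('X - (t (i + m.+1)%N)%:P) * P)); split.
- apply: leq_trans (size_scale_leq _ _) _.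
  apply: leq_trans (size_polyD _ _) _; rewrite size_polyN geq_max.
  by apply/andP; split; apply: leq_trans (size_polyMleq _ _) _; rewrite size_XsubC.
- rewrite ddS coefZ coefB !mulrBl !coefB !coefXM !coefCM /= lP lQ.
  rewrite [Q`__]nth_default // [P`__]nth_default // !mulr0 !subr0 mulrC.
  by rewrite mulrBl.
move=> k km; rewrite !hornerE; case: k km => [|k] km.
  rewrite addn0 subrr mul0r add0r (_ : P.[_] = u i); last by have := hP 0%N; rewrite addn0; exact.
  by rewrite -mulNr opprB mulKf.
have hQk : Q.[t (i + k.+1)%N] = u (i + k.+1)%N by rewrite -addSnnS hQ.
case: (eqVneq k m) hQk => [-> hQk|km' hQk].
  by rewrite hQk subrr mul0r subr0 mulKf.
rewrite hQk hP; last by lia.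
rewrite -mulrBl (_ : _ - _ - _ = t (i + m.+1)%N - t i); last by ring.
by rewrite mulKf.
Qed.

Lemma dd_step u i m : (i + m.+1 < s)%N ->
  dd u i.+1 m = dd u i m + dd u i m.+1 * (t (i + m.+1)%N - t i).
Proof.
move=> im; have nz : t (i + m.+1)%N - t i != 0 by apply: tnz; lia.
by rewrite ddS divfK // addrC subrK.
Qed.

Lemma dd_leibniz u v i m : (i + m < s)%N ->
  dd (fun k => u k * v k) i m = \sum_(l < m.+1) dd u i l * dd v (i + l) (m - l).
Proof.
elim: m i => [|m IH] i im; first by rewrite big_ord1 addn0.
rewrite ddS !IH; try lia.
have nz : t (i + m.+1)%N - t i != 0 by apply: tnz; lia.
apply: (mulIf nz); rewrite divfK // mulr_suml.
(* [dd_step] brings both sums to the products [dd u i l * dd v (i.+1 + l) (m - l)], which cancel. In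
   the remainders, the coefficients t_(i+l) - t_i and t_(i+m+1) - t_(i+l) of one product of total
   order m + 1 add up to the denominator. *)
have -> : \sum_(l < m.+1) dd u i.+1 l * dd v (i.+1 + l) (m - l) =
   \sum_(l < m.+1) dd u i l * dd v (i.+1 + l) (m - l) +
   \sum_(l < m.+1) dd u i l.+1 * dd v (i.+1 + l) (m - l) * (t (i + l.+1)%N - t i).
  rewrite -big_split; apply: eq_bigr => -[l lm] _ /=.
  rewrite dd_step; last by lia.
  by rewrite mulrDl; congr (_ + _); rewrite mulrAC.
have -> : \sum_(l < m.+1) dd u i l * dd v (i + l) (m - l) =
   \sum_(l < m.+1) dd u i l * dd v (i.+1 + l) (m - l) -
   \sum_(l < m.+1) dd u i l * dd v (i + l) (m.+1 - l) * (t (i + m.+1)%N - t (i + l)%N).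
  rewrite -sumrB; apply: eq_bigr => -[l lm] _ /=.
  rewrite addSn dd_step; last by lia.
  rewrite (_ : (m - l).+1 = (m.+1 - l)%N); last by lia.
  rewrite (_ : (i + l + (m.+1 - l) = i + m.+1)%N); last by lia.
  by ring.
have E3 (a b c : K) : a + b - (a - c) = b + c by ring.
rewrite {}E3.
rewrite [RHS](eq_bigr (fun l : 'I_m.+2 => dd u i l * dd v (i + l) (m.+1 - l) * (t (i + l)%N - t i)
   + dd u i l * dd v (i + l) (m.+1 - l) * (t (i + m.+1)%N - t (i + l)%N))); last first.
  by move=> l _; ring.
rewrite [RHS]big_split /=; congr (_ + _).
  rewrite [RHS]big_ord_recl /= addn0 subrr mulr0 add0r; apply: eq_bigr => l _.
  by rewrite /bump /= add1n subSS addSnnS.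
by rewrite [RHS]big_ord_recr /= subrr mulr0 addr0.
Qed.

Lemma ddB u v i m : dd (fun k => u k - v k) i m = dd u i m - dd v i m.
Proof.
elim: m i => [|m IH] i //; rewrite !ddS !IH -mulrBl; congr (_ / _).
by rewrite !opprD !opprK addrACA.
Qed.

Lemma ddZ c u i m : dd (fun k => c * u k) i m = c * dd u i m.
Proof. by elim: m i => [|m IH] i //; rewrite !ddS !IH -mulrBr mulrA. Qed.

Lemma dd_cst c i m : dd (fun=> c) i m = if m is 0 then c else 0.
Proof.
elim: m i => [|m IH] i //; rewrite ddS !IH.
by rewrite subrr mul0r.
Qed.

Lemma dd_lagrange u : (0 < s)%N ->
  dd u 0 s.-1 = \sum_(i < s) u i / \prod_(j < s | j != i) (t i - t j).
Proof.
move=> s0; have [|P [sP <- hP]] := @neville u 0%N s.-1; first by rewrite prednK.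
pose rs := [seq t (val i) | i <- enum 'I_s].
have srs : size rs = s by rewrite size_map size_enum_ord.
have urs : uniq rs.
  rewrite map_inj_uniq ?enum_uniq // => i j /t_inj e; apply/val_inj/e; exact: ltn_ord.
have -> : s.-1 = (size rs).-1 by rewrite srs.
rewrite lagrange_lead ?srs //; last by rewrite -[s]prednK.
set D := \prod_(r <- rs) _; rewrite /rs big_map big_enum /=.
apply: eq_bigr => i _.
rewrite -(hP i) ?add0n; last by case: i => /= i; lia.
congr (_ / _); rewrite /D big_map big_enum /= (bigD1 i) //= derivM derivXsubC mul1r.
rewrite !hornerE subrr mul0r addr0 horner_prod; apply: eq_bigr => j _.
by rewrite !hornerE.
Qed.

End DividedDifferences.
Arguments dd : simpl never.

Lemma cvg_sum_fin (K : numFieldType) (T : Type) (F : set_system T) (FF : Filter F)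
    (I : Type) (r : seq I) (P : pred I) (f : I -> T -> K) (l : I -> K) :
  (forall i, P i -> f i @ F --> l i) ->
  (fun x => \sum_(i <- r | P i) f i x) @ F --> \sum_(i <- r | P i) l i.
Proof.
move=> h; elim: r => [|i r IH].
  rewrite big_nil; under eq_fun do rewrite big_nil; exact: cvg_cst.
rewrite big_cons; under eq_fun do rewrite big_cons.
by case: ifPn => // Pi; apply: cvgD => //; exact: h.
Qed.

Lemma cvg_prod_fin (K : numFieldType) (T : Type) (F : set_system T) (FF : Filter F)
    (I : Type) (r : seq I) (P : pred I) (f : I -> T -> K) (l : I -> K) :
  (forall i, P i -> f i @ F --> l i) ->
  (fun x => \prod_(i <- r | P i) f i x) @ F --> \prod_(i <- r | P i) l i.
Proof.
move=> h; elim: r => [|i r IH].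
  rewrite big_nil; under eq_fun do rewrite big_nil; exact: cvg_cst.
rewrite big_cons; under eq_fun do rewrite big_cons.
by case: ifPn => // Pi; apply: cvgM => //; exact: h.
Qed.

Lemma dd_ext (K : fieldType) (t u v : nat -> K) s i m :
  (forall k, (k < s)%N -> u k = v k) -> (i + m < s)%N ->
  dd t u i m = dd t v i m.
Proof.
move=> uv; elim: m i => [|m IH] i im; first by rewrite !dd0 uv //; lia.
by rewrite !ddS !IH //; lia.
Qed.

(** * Limits of divided differences along a filter *)

Section DDLimits.
Variables (K : numFieldType) (T : Type) (F : set_system T).
Hypothesis FF : Filter F.
Variables (t : T -> nat -> K) (s : nat).
Hypothesis t_inj : \forall x \near F, distinct_nodes (t x) s.
Implicit Types u v : T -> nat -> K.

(** Convergence of the values alone is too weak when nodes coalesce. This property is stable under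
    products, differences and inverses with nonzero limits, so it reaches a product of residue
    factors from exponentials and their quotients. *)
Definition dd_cvg u := forall i m, (i + m < s)%N ->
  exists l : K, (fun x => dd (t x) (u x) i m) @ F --> l.

Lemma dd_cvg_near u v :
  (\forall x \near F, forall k, (k < s)%N -> u x k = v x k) -> dd_cvg u -> dd_cvg v.
Proof.
move=> uv cu i m im; have [l hl] := cu i m im; exists l.
apply: cvg_trans hl; apply: near_eq_cvg.
by apply: filterS uv => x uv; exact: dd_ext im.
Qed.

Lemma dd_cvg_cst (c : T -> K) (l : K) : c @ F --> l -> dd_cvg (fun x _ => c x).
Proof.
move=> cl i m im; exists (if m is 0 then l else 0).
have h : \forall x \near F, (if m is 0 then c x else 0) = dd (t x) (fun _ => c x) i m.
  by apply: nearW => x; rewrite dd_cst.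
apply: cvg_trans (near_eq_cvg h) _.
by case: m {h im} => [|m] //; exact: cvg_cst.
Qed.

Lemma dd_cvgM u v : dd_cvg u -> dd_cvg v -> dd_cvg (fun x k => u x k * v x k).
Proof.
move=> cu cv i m im.
have hl (l : 'I_m.+1) : exists a : K,
    (fun x => dd (t x) (u x) i l * dd (t x) (v x) (i + l) (m - l)) @ F --> a.
  have [|a ha] := cu i l; first by case: l => /= l; lia.
  have [|b hb] := cv (i + l)%N (m - l)%N; first by case: l {ha} => /= l; lia.
  by exists (a * b); exact: cvgM.
have [a ha] := choice hl; exists (\sum_(l < m.+1) a l).
apply: cvg_trans (cvg_sum_fin _ (fun l _ => ha l)).
by apply: near_eq_cvg; apply: filterS t_inj => x tx; rewrite (dd_leibniz tx).
Qed.

Lemma dd_cvgB u v : dd_cvg u -> dd_cvg v -> dd_cvg (fun x k => u x k - v x k).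
Proof.
move=> cu cv i m im; have [a ha] := cu i m im; have [b hb] := cv i m im.
exists (a - b); apply: cvg_trans (cvgB ha hb); apply: near_eq_cvg.
by apply: nearW => x; rewrite ddB.
Qed.

Lemma dd_cvg_prod (I : Type) (r : seq I) (P : pred I) (u : I -> T -> nat -> K) :
  (forall i, P i -> dd_cvg (u i)) ->
  dd_cvg (fun x k => \prod_(i <- r | P i) u i x k).
Proof.
move=> h; elim: r => [|j r IH].
  apply: (@dd_cvg_near (fun _ _ => 1)); last by apply: dd_cvg_cst; exact: cvg_cst.
  by apply: nearW => x k _; rewrite big_nil.
have [Pj|Pj] := boolP (P j).
  apply: (@dd_cvg_near (fun x k => u j x k * \prod_(i <- r | P i) u i x k)).
    by apply: nearW => x k _; rewrite big_cons Pj.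
  by apply: dd_cvgM => //; exact: h.
apply: dd_cvg_near IH.
by apply: nearW => x k _; rewrite big_cons (negbTE Pj).
Qed.

(** The Leibniz rule for u * u^-1 = 1 has left side 0 in positive order, and solving for its first
    term expresses the divided difference of u^-1 through those of lower order. *)
Lemma dd_cvgV u : dd_cvg u ->
  (forall k, (k < s)%N -> exists l : K, l != 0 /\ (fun x => u x k) @ F --> l) ->
  dd_cvg (fun x k => (u x k)^-1).
Proof.
move=> cu nz i m; elim/ltn_ind: m i => m IH i im.
have [l [l0 hl]] := nz i ltac:(lia).
have unz : \forall x \near F, forall k, (k < s)%N -> u x k != 0.
  have : \forall x \near F, forall k : 'I_s, u x k != 0.
    apply: filter_forall => k; have [a [a0 ha]] := nz k (ltn_ord k).
    exact: cvgr_neq0 a0.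
  by apply: filterS => x hx k ks; have := hx (Ordinal ks).
case: m im IH => [|m] im IH.
  by exists l^-1; under eq_fun do rewrite dd0; exact: cvgV.
have hp (p : 'I_m.+1) : exists a : K,
    (fun x => dd (t x) (u x) i p.+1 * dd (t x) (fun k => (u x k)^-1) (i + p.+1) (m - p))
      @ F --> a.
  case: p => p pm /=; have [|a ha] := cu i p.+1; first by lia.
  have [||b hb] := IH (m - p)%N _ (i + p.+1)%N; try lia.
  by exists (a * b); exact: cvgM.
have [a ha] := choice hp.
exists (- l^-1 * \sum_(p < m.+1) a p).
apply: cvg_trans (cvgM (cvgN (cvgV l0 hl)) (cvg_sum_fin _ (fun p _ => ha p))).
apply: near_eq_cvg; near=> x.
have tx : distinct_nodes (t x) s by near: x.
have ux : forall k, (k < s)%N -> u x k != 0 by near: x.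
have ui : u x i != 0 by apply: ux; lia.
apply: (mulfI ui).
have : dd (t x) (fun k => u x k * (u x k)^-1) i m.+1 = 0.
  rewrite (@dd_ext _ _ _ (fun=> 1) s) ?dd_cst // => k ks.
  by rewrite divff ?ux.
rewrite (dd_leibniz tx) // big_ord_recl /= addn0 subn0 dd0 => /eqP.
rewrite addr_eq0 => /eqP ->.
rewrite /= mulNr mulrN mulrA divff // mul1r; congr (- _).
Unshelve. all: by end_near.
Qed.

End DDLimits.

(** * Mean value theorems for divided differences *)

Section MeanValue.
Variable R : realType.
Implicit Types (f g : nat -> R -> R) (lo hi : R).

Definition derivative_chain f := forall k (x : R), is_derive x 1 (f k) (f k.+1 x).

Lemma path_gt_head (x y : R) s : path <%R x s -> y \in s -> x < y.
Proof. by move=> /(order_path_min lt_trans)/allP; apply. Qed.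

(** Rolle gives a zero of f' inside each gap between consecutive zeros. That these points are new is
    recorded because a double zero of f supplies one more zero of f' at an old point. *)
Lemma rolle_path (f f' : R -> R) (s : seq R) (x : R) :
  (forall y : R, is_derive y 1 f (f' y)) ->
  path <%R x s -> (forall y, y \in x :: s -> f y = 0) ->
  exists s' : seq R, [/\ size s' = size s, path <%R x s',
    forall y, y \in s' -> f' y = 0, last x s' <= last x s &
    forall y, y \in s' -> y \notin x :: s].
Proof.
move=> df; elim: s x => [|y s IH] x /=; first by move=> _ _; exists [::].
move=> /andP[xy ys] f0.
have [|s' [ss ps fs ls ds]] := IH y ys.
  by move=> z zs; apply: f0; rewrite inE zs orbT.
have [|||c cxy dc] := @Rolle R f x y xy.
- by move=> z _; have [] := df z.
- apply: continuous_subspaceT => z.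
  by apply: differentiable_continuous; apply/derivable1_diffP; have [] := df z.
- by rewrite !f0 ?inE ?eqxx ?orbT.
have fc : f' c = 0 by have [_ <-] := df c; have [_ <-] := dc.
move: cxy; rewrite in_itv /= => /andP[xc cy].
exists (c :: s'); split => //=.
- by rewrite ss.
- rewrite xc /=; case: s' ps {ss fs ls ds} => //= z s' /andP[yz ->].
  by rewrite (lt_trans cy yz).
- by move=> z; rewrite inE => /predU1P[->|/fs].
- by case: s' ps ss ls {fs ds} => //= ps ss _; case: s ss ys {IH f0} => //= _ _; exact: ltW.
move=> z; rewrite !inE => /predU1P[->|zs'].
  rewrite !negb_or (gt_eqF xc) (lt_eqF cy) /=; apply/negP => cs.
  by have := lt_trans cy (path_gt_head ys cs); rewrite ltxx.
have := ds z zs'; rewrite inE !negb_or => /andP[-> ->]; rewrite !andbT.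
by rewrite gt_eqF // (lt_trans xy) // (path_gt_head ps).
Qed.

Lemma rolle_list (f f' : R -> R) (l : seq R) lo hi :
  (forall y : R, is_derive y 1 f (f' y)) -> uniq l ->
  {in l, forall y, f y = 0 /\ lo <= y <= hi} ->
  exists l' : seq R, [/\ uniq l', size l' = (size l).-1,
    {in l', forall y, f' y = 0 /\ lo <= y <= hi} & {in l', forall y, y \notin l}].
Proof.
move=> df ul hl; case E : (sort <=%R l) => [|x s].
  by exists [::]; split=> //; rewrite -(size_sort <=%R l) E.
have st : path <%R x s.
  rewrite -[path _ _ _]/(sorted <%R (x :: s)) -E lt_sorted_uniq_le sort_uniq ul /=.
  exact: sort_le_sorted.
have ml y : y \in x :: s -> y \in l by rewrite -E mem_sort.
have [|s' [ss ps fs ls ds]] := rolle_path df st.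
  by move=> y /ml/hl[].
have ub z : z \in s' -> z <= hi.
  have lhi : last x s <= hi by have [] := hl _ (ml _ (mem_last x s)) => _ /andP[].
  move=> zs; apply: le_trans lhi; apply: le_trans ls.
  case/splitPr: zs ps => p q; rewrite cat_path last_cat /= => /and3P[_ _ pq].
  by case: q pq => [|w q] pq //=; apply/ltW/(path_gt_head pq)/mem_last.
exists s'; split.
- by have := lt_sorted_uniq (path_sorted ps).
- by rewrite ss -(size_sort <=%R l) E.
- move=> y ys; split; first exact: fs.
  rewrite ub // andbT; apply: le_trans (ltW (path_gt_head ps ys)).
  by have [] := hl _ (ml _ (mem_head x s)) => _ /andP[].
by move=> y ys; have := ds y ys; rewrite -E mem_sort.
Qed.

Lemma rolle_chain f m (l : seq R) lo hi : derivative_chain f ->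
  uniq l -> size l = m.+1 -> {in l, forall y, f 0 y = 0 /\ lo <= y <= hi} ->
  exists2 xi, lo <= xi <= hi & f m xi = 0.
Proof.
elim: m f l => [|m IH] f l df ul sl hl.
  case: l ul sl hl => [|x l] // _ _ /(_ x (mem_head _ _))[fx xb].
  by exists x.
have [l' [ul' sl' hl' _]] := rolle_list (df 0%N) ul hl.
by apply: (IH (fun k => f k.+1) l') => //; rewrite sl' sl.
Qed.

Lemma derivative_chain_subpoly f (P : {poly R}) : derivative_chain f ->
  derivative_chain (fun k x => f k x - P^`(k).[x]).
Proof.
move=> df k x; rewrite derivnS.
have := is_deriveB (df k x) (is_derive_poly P^`(k) x).
by [].
Qed.

Lemma horner_derivn_top (P : {poly R}) m x : (size P <= m.+1)%N ->
  P^`(m).[x] = P`_m * m`!%:R.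
Proof.
move=> sP; have -> : P^`(m) = (P`_m * m`!%:R)%:P; last by rewrite hornerC.
apply/polyP => i; rewrite coef_derivn coefC; case: i => [|i].
  by rewrite addn0 ffactnn mulr_natr.
by rewrite nth_default ?mul0rn // (leq_trans sP) // addnS ltnS leq_addr.
Qed.

Section Nodes.
Variables (f : nat -> R -> R) (t : nat -> R) (s : nat) (lo hi : R).
Hypothesis df : derivative_chain f.
Hypothesis t_inj : distinct_nodes t s.
Hypothesis t_bnd : forall k, (k < s)%N -> lo <= t k <= hi.

Let nodes i m := [seq t k | k <- iota i m.+1].

Let nodes_uniq i m : (i + m < s)%N -> uniq (nodes i m).
Proof.
move=> im; rewrite map_inj_in_uniq ?iota_uniq // => a b.
by rewrite !mem_iota => ha hb; apply: t_inj; lia.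
Qed.

(** With P the interpolant, [f 0 - P] vanishes at m + 1 nodes, so by Rolle its m-th derivative has a
    zero, and that of P is m! times its top coefficient. *)
Lemma dd_mean_value i m : (i + m < s)%N ->
  exists2 xi, lo <= xi <= hi & dd t (fun k => f 0 (t k)) i m = f m xi / m`!%:R.
Proof.
move=> im; have [P [sP <- hP]] := neville t_inj (fun k => f 0 (t k)) im.
have [|||xi xib] := rolle_chain (m := m) (l := nodes i m) (lo := lo) (hi := hi)
  (derivative_chain_subpoly P df).
- exact: nodes_uniq.
- by rewrite size_map size_iota.
- move=> _ /mapP[k +  ->]; rewrite mem_iota => hk.
  rewrite derivn0 -{2}(subnKC (_ : i <= k)%N); last by lia.
  rewrite hP; last by lia.
  by rewrite subnKC ?subrr; [split=> //; apply: t_bnd; lia|lia].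
rewrite horner_derivn_top // => /eqP; rewrite subr_eq0 => /eqP e; exists xi => //.
by rewrite e mulfK // pnatr_eq0 -lt0n fact_gt0.
Qed.

(** A divided difference of the difference quotient at t_j is one of f with t_j adjoined to the
    nodes, as a double node if it is already among them. This raises the order by one. *)
Lemma dd_quotient_mean_value j i m : (j < s)%N -> (i + m < s)%N ->
  exists2 xi, lo <= xi <= hi &
    dd t (fun k => if k == j then f 1 (t j) else (f 0 (t k) - f 0 (t j)) / (t k - t j)) i m
      = f m.+1 xi / (m.+1)`!%:R.
Proof.
move=> js im; set q := fun k => if k == j then _ else _.
have [Q [sQ <- hQ]] := neville t_inj q im.
have {}hQ k : (i <= k <= i + m)%N -> Q.[t k] = q k.
  by move=> hk; have := hQ (k - i)%N; rewrite subnKC; [apply; lia|lia].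
(* Since Q interpolates the quotients, P interpolates f at the nodes and at t_j, and also matches
   the derivative at t_j when t_j is a node. *)
pose P : {poly R} := (f 0 (t j))%:P + ('X - (t j)%:P) * Q.
have sP : (size P <= m.+2)%N.
  apply: leq_trans (size_polyD _ _) _; rewrite geq_max size_polyC.
  apply/andP; split; first by case: eqP.
  by apply: leq_trans (size_polyMleq _ _) _; rewrite size_XsubC.
have lP : P`_m.+1 = Q`_m.
  rewrite coefD coefC /= add0r mulrBl coefB coefXM coefCM /=.
  by rewrite [Q`_m.+1]nth_default // mulr0 subr0.
have dg := derivative_chain_subpoly P df.
have zP k : (i <= k <= i + m)%N -> f 0 (t k) - P^`(0).[t k] = 0.
  move=> hk; rewrite derivn0 !hornerE.
  rewrite hQ //.
  rewrite /q; case: eqP => [->|kj]; first by rewrite subrr mul0r addr0 subrr.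
  rewrite mulrC divfK; first by ring.
  by rewrite subr_eq0; apply/eqP => /t_inj; lia.
have hz : {in nodes i m, forall y, f 0 y - P^`(0).[y] = 0 /\ lo <= y <= hi}.
  move=> _ /mapP[k + ->]; rewrite mem_iota => hk.
  by split; [apply: zP|apply: t_bnd]; lia.
have [xi xib] : exists2 xi, lo <= xi <= hi & f m.+1 xi - P^`(m.+1).[xi] = 0.
  (* If t_j is among the nodes then it is a double zero of f 0 - P. *)
  have [jn|jn] := boolP (t j \in nodes i m).
    have hj : (i <= j <= i + m)%N.
      by case/mapP: jn => k; rewrite mem_iota => hk /t_inj; lia.
    have [l' [ul' sl' hl' dl']] := rolle_list (dg 0%N) (nodes_uniq im) hz.
    apply: (rolle_chain (f := fun k x => f k.+1 x - P^`(k.+1).[x]) (l := t j :: l')).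
    - by move=> k x; exact: dg.
    - by rewrite /= ul' andbT; apply/negP => /dl'; rewrite jn.
    - by rewrite /= sl' size_map size_iota.
    move=> y; rewrite inE => /predU1P[->|/hl' //]; split; last exact: t_bnd.
    rewrite derivn1 derivD derivC add0r derivM derivXsubC mul1r !hornerE.
    rewrite subrr mul0r addr0.
    by rewrite hQ // /q eqxx subrr.
  apply: (rolle_chain (l := t j :: nodes i m)) dg _ _ _.
  - by rewrite cons_uniq jn; exact: nodes_uniq.
  - by rewrite /= size_map size_iota.
  move=> y; rewrite inE => /predU1P[->|/hz //]; split; last exact: t_bnd.
  by rewrite derivn0 !hornerE subrr mul0r addr0 subrr.
rewrite horner_derivn_top // lP => /eqP; rewrite subr_eq0 => /eqP e; exists xi => //.
by rewrite e mulfK // pnatr_eq0 -lt0n fact_gt0.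
Qed.

End Nodes.
End MeanValue.

(** * The complex exponential *)

Section ComplexExp.
Variable R : realType.
Implicit Types (z w g : R[i]).

Lemma realcD (x y : R) : (x + y)%:C = x%:C + y%:C. Proof. exact: rmorphD. Qed.
Lemma realcB (x y : R) : (x - y)%:C = x%:C - y%:C. Proof. exact: rmorphB. Qed.
Lemma realcN (x : R) : (- x)%:C = - x%:C. Proof. exact: rmorphN. Qed.
Lemma realcM (x y : R) : (x * y)%:C = x%:C * y%:C. Proof. exact: rmorphM. Qed.
Lemma realcV (x : R) : (x^-1)%:C = x%:C^-1. Proof. exact: fmorphV. Qed.
Lemma realc_eq0 (x : R) : (x%:C == 0) = (x == 0). Proof. exact: fmorph_eq0. Qed.

Lemma cexpD z w : cexp (z + w) = cexp z * cexp w.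
Proof.
case: z w => [a b] [c d]; rewrite /cexp /= expRD cosD sinD.
by simpc; congr (_ +i* _); ring.
Qed.

Lemma cexp0 : cexp (0 : R[i]) = 1.
Proof. by rewrite /cexp /= expR0 cos0 sin0 mul1r. Qed.

Lemma cexp_neq0 z : cexp z != 0.
Proof.
apply/eqP => e; have := cexpD z (- z); rewrite e mul0r subrr cexp0 => /eqP.
by rewrite oner_eq0.
Qed.

Lemma cexpN z : cexp (- z) = (cexp z)^-1.
Proof.
apply: (mulfI (cexp_neq0 z)); rewrite -cexpD subrr cexp0 divff //.
exact: cexp_neq0.
Qed.

Lemma cexpMn z (n : nat) : cexp (z *+ n) = cexp z ^+ n.
Proof.
elim: n => [|n IH]; first by rewrite mulr0n cexp0 expr0.
by rewrite mulrS cexpD IH exprS.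
Qed.

Lemma cexpMz z (m : int) : cexp (z *~ m) = cexp z ^ m.
Proof. by case: m => n; rewrite ?NegzE ?mulrNz ?cexpN cexpMn // -exprnN. Qed.

(** The mean value theorem fails for complex-valued functions; it is applied to the real part of
    every multiple by a constant k0 instead. *)
Lemma derivative_chain_cexp (k0 g : R[i]) :
  derivative_chain (fun n (x : R) => Re (k0 * g ^+ n * cexp (g * x%:C))).
Proof.
move=> n x; rewrite exprSr mulrA; move: (k0 * _) => {}k0.
case: k0 g => [p q] [a b].
rewrite (_ : (fun y => _) = (expR \o (a *: id)) *
    (p *: (cos \o (b *: id)) - q *: (sin \o (b *: id)))); last first.
  by apply/funext => y; rewrite /cexp; simpc => /=; rewrite !fctE /GRing.scale /=; ring.
apply: is_derive_eq.
rewrite /cexp; simpc => /=; rewrite !fctE /GRing.scale /=; ring.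
Qed.

Lemma Re_real_mul (x : R) z : Re (x%:C * z) = x * Re z.
Proof. by case: z => a b /=; rewrite mul0r subr0. Qed.
Lemma Im_real_mul (x : R) z : Im (x%:C * z) = x * Im z.
Proof. by case: z => a b /=; rewrite mul0r addr0. Qed.

Lemma Re_dd (t : nat -> R) (u : nat -> R[i]) i m :
  Re (dd (fun k => (t k)%:C) u i m) = dd t (fun k => Re (u k)) i m.
Proof.
elim: m i => [|m IH] i //; rewrite !ddS -!IH -rmorphB -fmorphV mulrC Re_real_mul.
by rewrite mulrC raddfB.
Qed.

Lemma cvg_real_complex (T : Type) (F : set_system T) (FF : Filter F) (f : T -> R) (a : R) :
  f @ F --> a -> cvgc F (fun x => (f x)%:C) a%:C.
Proof.
move=> fa; apply/(@cvgrPdist_lt _ (R[i])^o) => e e0.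
have er : e = (Re e)%:C by case: e e0 => u v; rewrite ltcE /= => /andP[/eqP -> _].
move: e0; rewrite er ltcR => e0.
move/cvgrPdist_lt: fa => /(_ _ e0); apply: filterS => x.
by rewrite -rmorphB /= normc_def /= expr0n /= addr0 sqrtr_sqr ltcR.
Qed.

Lemma cvg_complex (T : Type) (F : set_system T) (FF : Filter F) (f : T -> R[i]) (l : R[i]) :
  (fun x => Re (f x)) @ F --> Re l -> (fun x => Im (f x)) @ F --> Im l ->
  cvgc F f l.
Proof.
move=> fr fi; rewrite (complexE l).
rewrite (_ : f = (fun x => (Re (f x))%:C + 'i * (Im (f x))%:C)); last first.
  by apply/funext => x; exact: complexE.
apply: (@cvgD _ (R[i])^o); first exact: cvg_real_complex.
by apply: (@cvgM (R[i])); [exact: cvg_cst|exact: cvg_real_complex].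
Qed.

Lemma cvg_Re (T : Type) (F : set_system T) (FF : Filter F) (f : T -> R[i]) (l : R[i]) :
  cvgc F f l -> (fun x => Re (f x)) @ F --> Re l.
Proof.
move=> fl; apply/cvgrPdist_lt => e e0.
have ec : 0 < (e%:C : R[i]) by rewrite ltcR.
move/(@cvgrPdist_lt _ (R[i])^o): fl => /(_ _ ec); apply: filterS => x.
by rewrite -raddfB -ltcR; apply: le_lt_trans; exact: normc_ge_Re.
Qed.

Lemma cvg_Im (T : Type) (F : set_system T) (FF : Filter F) (f : T -> R[i]) (l : R[i]) :
  cvgc F f l -> (fun x => Im (f x)) @ F --> Im l.
Proof.
move=> fl.
have h z : Im z = Re (- 'i * z) by case: z => a b /=; ring.
rewrite h; under eq_fun do rewrite h.
have c : cvgc F (fun x => - 'i * f x) (- 'i * l).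
  by apply: (@cvgM (R[i]) _ _ _ (fun=> - 'i) f) fl; exact: cvg_cst.
exact: cvg_Re c.
Qed.

Lemma cvg_cexp (T : Type) (F : set_system T) (FF : Filter F) (f : T -> R[i]) (l : R[i]) :
  cvgc F f l -> cvgc F (fun x => cexp (f x)) (cexp l).
Proof.
move=> fl; have fr := cvg_Re FF fl; have fi := cvg_Im FF fl.
have e : (fun x => expR (Re (f x))) @ F --> expR (Re l).
  exact: (continuous_cvg FF (@continuous_expR R _) fr).
have c : (fun x => cos (Im (f x))) @ F --> cos (Im l).
  exact: (continuous_cvg FF (@continuous_cos R _) fi).
have s : (fun x => sin (Im (f x))) @ F --> sin (Im l).
  exact: (continuous_cvg FF (@continuous_sin R _) fi).
rewrite /cexp; apply: (@cvgM (R[i])); first exact: cvg_real_complex e.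
exact: cvg_complex.
Qed.

Lemma cvgcM (T : Type) (F : set_system T) (FF : Filter F) (f g : T -> R[i])
    (a b : R[i]) : cvgc F f a -> cvgc F g b ->
  cvgc F (fun x => f x * g x) (a * b).
Proof. by move=> fa gb; exact: (@cvgM (R[i]) _ _ _ _ _ _ _ fa gb). Qed.

Lemma cvgcV (T : Type) (F : set_system T) (FF : Filter F) (f : T -> R[i])
    (a : R[i]) : a != 0 -> cvgc F f a -> cvgc F (fun x => (f x)^-1) a^-1.
Proof. by move=> a0 fa; exact: (@cvgV (R[i]) _ _ _ _ _ a0 fa). Qed.

Lemma cvgcB (T : Type) (F : set_system T) (FF : Filter F) (f g : T -> R[i])
    (a b : R[i]) : cvgc F f a -> cvgc F g b -> cvgc F (fun x => f x - g x) (a - b).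
Proof. by move=> fa gb; exact: (@cvgB _ (R[i])^o _ _ _ _ _ _ _ fa gb). Qed.

Lemma cvgcD (T : Type) (F : set_system T) (FF : Filter F) (f g : T -> R[i])
    (a b : R[i]) : cvgc F f a -> cvgc F g b -> cvgc F (fun x => f x + g x) (a + b).
Proof. by move=> fa gb; exact: (@cvgD _ (R[i])^o _ _ _ _ _ _ _ fa gb). Qed.

Lemma cvgc_near_neq (T : Type) (F : set_system T) (FF : Filter F) (f : T -> R[i])
    (l c : R[i]) : cvgc F f l -> l != c -> \forall x \near F, f x != c.
Proof.
move=> fl lc; have nz : l - c != 0 by rewrite subr_eq0.
have h := cvgcB FF fl (@cvg_cst (R[i])^o c _ _ FF).
have := @cvgr_neq0 _ (R[i])^o _ _ FF _ _ h nz.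
by apply: filterS => x; rewrite subr_eq0.
Qed.

Lemma cvgcN (T : Type) (F : set_system T) (FF : Filter F) (f : T -> R[i])
    (a : R[i]) : cvgc F f a -> cvgc F (fun x => - f x) (- a).
Proof. by move=> fa; exact: (@cvgN _ (R[i])^o _ _ _ _ _ fa). Qed.

Lemma cvgc_cst (T : Type) (F : set_system T) (FF : Filter F) (a : R[i]) :
  cvgc F (fun _ : T => a) a.
Proof. exact: (@cvg_cst (R[i])^o). Qed.

Arguments cvgc_cst {T F} FF a.

Lemma cvgc_ext (T : Type) (F : set_system T) (f g : T -> R[i]) (a b : R[i]) :
  (forall x, f x = g x) -> a = b -> cvgc F f a -> cvgc F g b.
Proof. by move=> /funext -> ->. Qed.

Lemma cvg_complex_Re (T : Type) (F : set_system T) (FF : Filter F)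
    (f : T -> R[i]) (l : R[i]) :
  (forall k0 : R[i], (fun x => Re (k0 * f x)) @ F --> Re (k0 * l)) -> cvgc F f l.
Proof.
move=> h; apply: cvg_complex.
  by have := h 1; under eq_fun do rewrite mul1r; rewrite mul1r.
have e z : Im z = Re (- 'i * z) by case: z => a b /=; ring.
by rewrite e; under eq_fun do rewrite e; exact: h.
Qed.

(** The intermediate point depends on k0 and on x, but it is squeezed to tau, so the limit of the
    right-hand side is the same linear expression in k0; testing all k0 recovers the complex
    limit. *)
Lemma cvg_mean_value (T : Type) (F : set_system T) (FF : Filter F)
    (f g : T -> R[i]) (g0 : R[i]) (r : T -> R) (tau : R) (p : nat) :
  r @ F --> 0 -> cvgc F g g0 ->
  (\forall x \near F, forall k0 : R[i], exists2 xi, tau - r x <= xi <= tau + r x &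
     Re (k0 * f x) = Re (k0 * g x ^+ p * cexp (g x * xi%:C)) / p`!%:R) ->
  cvgc F f (g0 ^+ p * cexp (g0 * tau%:C) / p`!%:R).
Proof.
move=> r0 gg h; apply: cvg_complex_Re => k0.
have [xi hxi] : exists xi : T -> R, \forall x \near F, tau - r x <= xi x <= tau + r x /\
     Re (k0 * f x) = Re (k0 * g x ^+ p * cexp (g x * (xi x)%:C)) / p`!%:R.
  have : forall x, exists y, (forall k0 : R[i], exists2 xi, tau - r x <= xi <= tau + r x &
     Re (k0 * f x) = Re (k0 * g x ^+ p * cexp (g x * xi%:C)) / p`!%:R) ->
    tau - r x <= y <= tau + r x /\
     Re (k0 * f x) = Re (k0 * g x ^+ p * cexp (g x * y%:C)) / p`!%:R.
    move=> x; have [hx|hx] := pselect (forall k0 : R[i], exists2 xi, tau - r x <= xi <= tau + r x &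
     Re (k0 * f x) = Re (k0 * g x ^+ p * cexp (g x * xi%:C)) / p`!%:R).
      by have [y y1 y2] := hx k0; exists y.
    by exists 0 => /hx.
  by move=> /choice[xi hxi]; exists xi; apply: filterS h => x /hxi.
have xt : xi @ F --> tau.
  apply: (squeeze_cvgr (f := fun x => tau - r x) (h := fun x => tau + r x)).
  - by apply: filterS hxi => x [].
  - by rewrite -[X in _ --> X]subr0; apply: cvgB => //; exact: cvg_cst.
  - by rewrite -[X in _ --> X]addr0; apply: cvgD => //; exact: cvg_cst.
have gp q : cvgc F (fun x => g x ^+ q) (g0 ^+ q).
  elim: q => [|q IH]; first exact: cvgc_cst.
  by apply: cvgc_ext (cvgcM FF gg IH) => [x|]; rewrite exprS.
have ce := cvg_cexp FF (cvgcM FF gg (cvg_real_complex FF xt)).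
have c0 := cvgcM FF (cvgc_cst FF k0)
  (cvgcM FF (cvgcM FF (gp p) ce) (cvgc_cst FF (p`!%:R)^-1)).
apply: cvg_trans (cvg_Re FF c0); apply: near_eq_cvg.
apply: filterS hxi => x [_ ->].
rewrite mulrA mulrA -(rmorph_nat (real_complex R)) -fmorphV mulrC Re_real_mul.
by rewrite mulrC.
Qed.

Section NodeFamilies.
Variables (T : Type) (F : set_system T) (t : T -> nat -> R) (s : nat) (tau : R)
  (g : T -> R[i]) (g0 : R[i]).
Hypothesis FF : Filter F.
Hypothesis t_inj : \forall x \near F, distinct_nodes (t x) s.
Hypothesis t_cvg : forall k, (k < s)%N -> (fun x => t x k) @ F --> tau.
Hypothesis g_cvg : cvgc F g g0.

Let r x := \sum_(k < s) `|t x k - tau|.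

Let r_cvg : r @ F --> 0.
Proof.
rewrite (_ : 0 = \sum_(k < s) (0 : R)); last by rewrite big1.
apply: cvg_sum_fin => k _.
rewrite -[X in _ --> X](normr0 R^o); apply: cvg_norm; rewrite -[X in _ --> X](subrr tau).
by apply: cvgB; [exact: t_cvg|exact: cvg_cst].
Qed.

Let t_bnd x k : (k < s)%N -> tau - r x <= t x k <= tau + r x.
Proof.
move=> ks; rewrite -ler_distl /r (bigD1 (Ordinal ks)) //= lerDl.
exact: sumr_ge0.
Qed.

Lemma cvg_dd_cexp i m : (i + m < s)%N ->
  cvgc F (fun x => dd (fun k => (t x k)%:C) (fun k => cexp (g x * (t x k)%:C)) i m)
    (g0 ^+ m * cexp (g0 * tau%:C) / m`!%:R).
Proof.
move=> im; apply: (cvg_mean_value FF r_cvg g_cvg); apply: filterS t_inj => x tx k0.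
have [xi xib e] := dd_mean_value (derivative_chain_cexp k0 (g x)) tx
   (t_bnd x) im.
by exists xi; rewrite // -e -ddZ Re_dd; congr dd; apply/funext => k; rewrite expr0 mulr1.
Qed.

Lemma dd_cvg_cexp : dd_cvg F (fun x k => (t x k)%:C) s
  (fun x k => cexp (g x * (t x k)%:C)).
Proof. by move=> i m /cvg_dd_cexp; eexists; eassumption. Qed.

(** Up to sign and a nonvanishing exponential, this is a factor of a cluster with its zero at node j
    divided out. *)
Definition cexp_quotient j x k :=
  if k == j then g x * cexp (g x * (t x j)%:C)
  else (cexp (g x * (t x k)%:C) - cexp (g x * (t x j)%:C)) / (t x k - t x j)%:C.

Lemma cvg_dd_cexp_quotient j i m : (j < s)%N -> (i + m < s)%N ->
  cvgc F (fun x => dd (fun k => (t x k)%:C) (cexp_quotient j x) i m)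
    (g0 ^+ m.+1 * cexp (g0 * tau%:C) / (m.+1)`!%:R).
Proof.
move=> js im; apply: (cvg_mean_value FF r_cvg g_cvg); apply: filterS t_inj => x tx k0.
have [xi xib e] := dd_quotient_mean_value (derivative_chain_cexp k0 (g x)) tx
   (t_bnd x) js im.
exists xi; rewrite // -e -ddZ Re_dd; congr dd; apply/funext => k; rewrite /cexp_quotient.
case: eqP => [_|_]; first by rewrite expr1 mulrA.
rewrite expr0 mulr1 -raddfB -mulrBr -fmorphV mulrA mulrC Re_real_mul.
by rewrite mulrC.
Qed.

Lemma dd_cvg_cexp_quotient j : (j < s)%N ->
  dd_cvg F (fun x k => (t x k)%:C) s (cexp_quotient j).
Proof. by move=> js i m /(cvg_dd_cexp_quotient js); eexists; eassumption. Qed.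

End NodeFamilies.
End ComplexExp.
Arguments cvgc_cst {R T F} FF a.

(** * Clusters of residues *)

Section ClusterLimit.
Variables (R : realType) (N : nat) (w : 'I_N -> int) (L : R[i]).
Implicit Types (c d : 'I_N -> R) (zeta : R[i]).

(* The deformed factor j is 1 - x^(1 + d_j) T^(c_j).  Factor i vanishes at T = zeta x^node
   with zeta^(w_i) = 1, where T^(c_j) stands for zeta^(w_j) x^(c_j * node). *)
Definition node c d (i : 'I_N) : R := - (1 + d i) / c i.

Definition residue_term c d (i : 'I_N) zeta : R[i] :=
  1 / ((- c i)%:C *
       \prod_(j | j != i) (1 - zeta ^ w j * cexp (L * (1 + d j + c j * node c d i)%:C))).

Variables (a : nat) (zeta : R[i]).
Hypothesis a_gt0 : (0 < a)%N.
Hypothesis zeta_root : zeta ^+ a = 1.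
Hypothesis L_neq0 : L != 0.

Let S : pred 'I_N := fun i => w i == - a%:Z.
Let s := #|S|.

Hypothesis nondeg : forall j, ~~ S j ->
  1 - zeta ^ w j * cexp (L * (1 + (w j)%:~R / a%:R)%:C) != 0.

(* The nodes in S coalesce in the limit; since the factors with index in S vanish at the
   coinciding nodes, dividing them by differences of nodes makes the Lagrange form of a
   divided difference appear. *)
Lemma cluster_sum_dd c d (i0 : 'I_N) :
  let idx := nth i0 (enum S) in
  let t k := node c d (idx k) in
  let v j k := if S j
     then - cexp_quotient (fun _ => t) (fun _ => L * (c j)%:C) (index j (enum S)) tt k
            / cexp (L * (c j)%:C * (node c d j)%:C)
     else 1 - zeta ^ w j * cexp (L * (1 + d j)%:C) * cexp (L * (c j)%:C * (t k)%:C) in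
  (forall i, S i -> c i != 0) ->
  {in S &, injective (node c d)} -> S i0 ->
  \sum_(i | S i) residue_term c d i zeta =
  dd (fun k => (t k)%:C) (fun k => L * (\prod_j v j k)^-1) 0 s.-1.
Proof.
move=> idx t v c0 ninj Si0.
have sidx k : (k < s)%N -> S (idx k).
  by move=> ks; have := mem_nth i0 (s := enum S) (n := k); rewrite -cardE mem_enum; apply.
have s0 : (0 < s)%N by apply/card_gt0P; exists i0.
have tinj : distinct_nodes (fun k => (t k)%:C) s.
  move=> k k' ks ks' /complexI/ninj; rewrite !unfold_in => /(_ (sidx _ ks) (sidx _ ks')).
  by move/eqP; rewrite nth_uniq ?enum_uniq -?cardE // => /eqP.
rewrite (dd_lagrange tinj) // -big_enum (big_nth i0) -cardE big_mkord.
apply: eq_bigr => k _; rewrite -/(idx k); set i := idx k.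
have Si : S i by exact: sidx.
have ci := c0 _ Si.
have zS j : S j -> zeta ^ w j = 1.
  by move=> /eqP ->; rewrite -exprnN zeta_root invr1.
have iidx : index i (enum S) = k by rewrite /i /idx index_uniq ?enum_uniq -?cardE.
have tidx j : S j -> t (index j (enum S)) = node c d j.
  by move=> Sj; rewrite /t /idx nth_index // mem_enum.
(* As 1 + d_j = - c_j node_j, factor j at node i is 1 - exp(L c_j (node_i - node_j)), that is, minus
   a difference of exponentials over exp(L c_j node_j). *)
have vS j : S j -> j != i -> v j k = (1 - zeta ^ w j * cexp (L * (1 + d j + c j * node c d i)%:C))
    / (node c d i - node c d j)%:C.
  move=> Sj ji; rewrite /v Sj zS // mul1r /cexp_quotient tidx //.
  rewrite (_ : (k == _ :> nat) = false); last first.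
    by apply: contra_neqF ji => /eqP e; rewrite /i e /idx nth_index ?mem_enum.
  rewrite (_ : 1 + d j + _ = c j * node c d i - c j * node c d j); last first.
    by rewrite [c j * node c d j]mulrC [node c d j]/node divfK ?c0 // opprK addrC.
  rewrite /t -/i; move: (node c d i) (node c d j) => ni nj.
  rewrite [(c j * _ - _)%:C]realcB mulrBr cexpD cexpN !realcM !mulrA.
  have := cexp_neq0 (L * (c j)%:C * nj%:C).
  set X := cexp (_ * ni%:C); set Y := cexp _; set z := (_ - _)%:C => Y0.
  by rewrite -(mulNr (X - Y)) opprB mulrAC mulrBl divff.
(* At its own node the quotient is a derivative. This yields the prefactor [- c i] of
   [residue_term], and the extra L is compensated by the L in the values of the divided
   difference. *)
have vi : v i k = - (L * (c i)%:C).
  by rewrite /v Si /cexp_quotient iidx eqxx /t -/i mulNr mulfK // cexp_neq0.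
have vN j : ~~ S j -> v j k = 1 - zeta ^ w j * cexp (L * (1 + d j + c j * node c d i)%:C).
  move=> Sj; rewrite /v (negbTE Sj) -mulrA -cexpD; congr (1 - _ * cexp _).
  by rewrite /t -/i [(_ + c j * _)%:C]realcD mulrDr [(c j * _)%:C]realcM mulrA.
set E := fun j => 1 - zeta ^ w j * cexp (L * (1 + d j + c j * node c d i)%:C) in vS vN.
have -> : \prod_(j < s | j != k) ((t k)%:C - (t j)%:C) =
    \prod_(j | S j && (j != i)) (node c d i - node c d j)%:C.
  rewrite -[RHS]/(\prod_(j in S | j != i) (node c d i - node c d j)%:C).
  rewrite -big_enum_cond (big_nth i0) -cardE big_mkord.
  apply: eq_big => [j|j _]; last by rewrite realcB.
  by rewrite /i /idx nth_uniq ?enum_uniq -?cardE.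
rewrite (bigD1 i) //= vi /residue_term.
have -> : \prod_(j | j != i) v j k = (\prod_(j | j != i) E j) /
    \prod_(j | S j && (j != i)) (node c d i - node c d j)%:C.
  rewrite (bigID S) /= [X in _ = X / _](bigID S) /= mulrAC; congr (_ * _).
    under [X in _ = _ / X]eq_bigl => j do rewrite andbC.
    by rewrite -prodf_div; apply: eq_bigr => j /andP[ji Sj]; exact: vS.
  by apply: eq_bigr => j /andP[ji Sj]; exact: vN.
set P := \prod_(j | S j && _) _.
have P0 : P != 0.
  apply/prodf_neq0 => j /andP[Sj ji]; rewrite realc_eq0 subr_eq0.
  apply: contra_neq ji => /ninj.
  by rewrite !unfold_in => ->.
have cC : (c i)%:C != 0 by rewrite realc_eq0.
rewrite realcN; set Q := \prod_(j | _) E j.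
rewrite div1r !invfM !invrK !invrN.
transitivity ((L / L) * (P / P) * (- ((c i)%:C^-1) * Q^-1)).
  by rewrite !divff // !mul1r.
by rewrite !invfM; ring.
Qed.

Variables (T : Type) (F : set_system T) (c d : T -> 'I_N -> R).
Hypothesis FF : Filter F.
Hypothesis c_cvg : forall i, (fun x => c x i) @ F --> ((w i)%:~R : R).
Hypothesis d_cvg : forall i, (fun x => d x i) @ F --> (0 : R).
Hypothesis node_inj : \forall x \near F, {in S &, injective (node (c x) (d x))}.

Let wS i : S i -> (w i)%:~R = - a%:R :> R.
Proof. by move=> /eqP ->; rewrite rmorphN. Qed.

Let aR_neq0 : a%:R != 0 :> R. Proof. by rewrite pnatr_eq0 -lt0n. Qed.

Lemma cvg_node i : S i -> (fun x => node (c x) (d x) i) @ F --> (a%:R^-1 : R).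
Proof.
move=> Si; rewrite (_ : a%:R^-1 = - (1 + 0) / (w i)%:~R); last first.
  by rewrite wS // addr0 mulN1r invrN opprK.
have w0 : (w i)%:~R != 0 :> R by rewrite wS // oppr_eq0.
have n_cvg : (fun x => - (1 + d x i)) @ F --> (- (1 + 0) : R).
  by apply: cvgN; apply: cvgD; [exact: cvg_cst|exact: d_cvg].
exact: cvgM n_cvg (cvgV w0 (@c_cvg i)).
Qed.

(** Every [v j] has convergent divided differences and a nonzero limit at each node, hence so has
    the inverse of their product. Existence is enough: the value is found later along a path. *)
Lemma cvg_cluster_sum :
  exists l, cvgc F (fun x => \sum_(i | S i) residue_term (c x) (d x) i zeta) l.
Proof.
have [Sex|Sno] := pselect (exists i, S i); last first.
  exists 0; rewrite (_ : (fun x => _) = fun=> 0); first exact: cvgc_cst.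
  by apply/funext => x; rewrite big1 // => i Si; case: Sno; exists i.
have [i0 Si0] := Sex.
pose idx := nth i0 (enum S).
pose t x k := node (c x) (d x) (idx k).
pose v j x k := if S j
     then - cexp_quotient t (fun x => L * (c x j)%:C) (index j (enum S)) x k
            / cexp (L * (c x j)%:C * (node (c x) (d x) j)%:C)
     else 1 - zeta ^ w j * cexp (L * (1 + d x j)%:C) * cexp (L * (c x j)%:C * (t x k)%:C).
have sidx k : (k < s)%N -> S (idx k).
  by move=> ks; have := mem_nth i0 (s := enum S) (n := k); rewrite -cardE mem_enum; apply.
have s0 : (0 < s)%N by apply/card_gt0P; exists i0.
have t_inj : \forall x \near F, distinct_nodes (t x) s.
  apply: filterS node_inj => x nx k k' ks ks' /nx; rewrite !unfold_in.
  move=> /(_ (sidx _ ks) (sidx _ ks')).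
  by move/eqP; rewrite nth_uniq ?enum_uniq -?cardE // => /eqP.
have tC_inj : \forall x \near F, distinct_nodes (fun k => (t x k)%:C) s.
  by apply: filterS t_inj => x tx k k' ks ks' /complexI; exact: tx.
have t_cvg k : (k < s)%N -> (fun x => t x k) @ F --> (a%:R^-1 : R).
  by move=> /sidx; exact: cvg_node.
have g_cvg j : cvgc F (fun x => L * (c x j)%:C) (L * ((w j)%:~R)%:C).
  by apply: cvgcM; [exact: cvgc_cst|exact: cvg_real_complex].
have f_cvg j : S j -> cvgc F (fun x => cexp (L * (c x j)%:C * (node (c x) (d x) j)%:C))
    (cexp (L * ((w j)%:~R)%:C * (a%:R^-1)%:C)).
  move=> Sj; apply: cvg_cexp; apply: cvgcM => //.
  by apply: cvg_real_complex; exact: cvg_node.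
have ed_cvg j : cvgc F (fun x => zeta ^ w j * cexp (L * (1 + d x j)%:C))
      (zeta ^ w j * cexp (L * 1%:C)).
  apply: cvgcM; first exact: cvgc_cst.
  apply: cvg_cexp; apply: cvgcM; first exact: cvgc_cst.
  apply: cvg_real_complex; rewrite -[X in _ --> X]addr0.
  by apply: cvgD => //; exact: cvg_cst.
have finv_cvg j : S j -> cvgc F (fun x => - (cexp (L * (c x j)%:C * (node (c x) (d x) j)%:C))^-1)
    (- (cexp (L * ((w j)%:~R)%:C * (a%:R^-1)%:C))^-1).
  by move=> Sj; apply: cvgcN; apply: cvgcV (f_cvg j Sj); exact: cexp_neq0.
have idx_lt j : S j -> (index j (enum S) < s)%N.
  by move=> Sj; rewrite /s cardE index_mem mem_enum.
have vE j x k : v j x k = if S j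
     then cexp_quotient t (fun x => L * (c x j)%:C) (index j (enum S)) x k
            * - (cexp (L * (c x j)%:C * (node (c x) (d x) j)%:C))^-1
     else 1 - zeta ^ w j * cexp (L * (1 + d x j)%:C) * cexp (L * (c x j)%:C * (t x k)%:C).
  by rewrite /v; case: ifP => // _; rewrite mulrN mulNr.
have v_cvg j : dd_cvg F (fun x k => (t x k)%:C) s (v j).
  have [Sj|Sj] := boolP (S j).
    apply: (@dd_cvg_near _ _ _ FF _ _ (fun x k =>
      cexp_quotient t (fun x => L * (c x j)%:C) (index j (enum S)) x k
            * - (cexp (L * (c x j)%:C * (node (c x) (d x) j)%:C))^-1)).
      by apply: nearW => x k _; rewrite vE Sj.
    apply: dd_cvgM => //; last exact: (dd_cvg_cst FF _ (finv_cvg j Sj)).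
    exact: (dd_cvg_cexp_quotient FF t_inj t_cvg (g_cvg j) (idx_lt j Sj)).
  apply: (@dd_cvg_near _ _ _ FF _ _ (fun x k => 1 -
      zeta ^ w j * cexp (L * (1 + d x j)%:C) * cexp (L * (c x j)%:C * (t x k)%:C))).
    by apply: nearW => x k _; rewrite vE (negbTE Sj).
  apply: dd_cvgB; first exact: (dd_cvg_cst FF _ (cvgc_cst FF 1)).
  apply: dd_cvgM => //; first exact: (dd_cvg_cst FF _ (ed_cvg j)).
  exact: (dd_cvg_cexp FF t_inj t_cvg (g_cvg j)).
have v_lim j k : (k < s)%N -> exists l : R[i], l != 0 /\ cvgc F (fun x => v j x k) l.
  move=> ks; have k0s : (k + 0 < s)%N by rewrite addn0.
  have [Sj|Sj] := boolP (S j); last first.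
    have h := cvg_dd_cexp FF t_inj t_cvg (g_cvg j) k0s.
    exists (1 - zeta ^ w j * cexp (L * (1 + (w j)%:~R / a%:R)%:C)); split; first exact: nondeg.
    apply: cvgc_ext (cvgcB FF (cvgc_cst FF 1) (cvgcM FF (ed_cvg j) h)) => [x|].
      by rewrite vE (negbTE Sj).
    rewrite expr0 mul1r fact0 divr1 -[L * _ * _]mulrA -realcM -[_ * cexp _ * _]mulrA.
    by rewrite -cexpD -mulrDr -realcD.
  (* For j in the cluster the exponentials cancel in the limit and leave - L w_j, which is
     nonzero. *)
  have h := cvg_dd_cexp_quotient FF t_inj t_cvg (g_cvg j) (idx_lt j Sj) k0s.
  eexists; split; last first.
    apply: cvgc_ext (cvgcM FF h (finv_cvg j Sj)) => [x|]; last by [].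
    by rewrite vE Sj.
  rewrite mulf_neq0 ?oppr_eq0 ?invr_neq0 ?cexp_neq0 // divr1 expr1.
  by rewrite mulf_neq0 ?cexp_neq0 // mulf_neq0 // realc_eq0 wS // oppr_eq0.
have [l hl] : exists l, cvgc F
   (fun x => dd (fun k => (t x k)%:C) (fun k => L * (\prod_j v j x k)^-1) 0 s.-1) l.
  apply: (@dd_cvgM _ _ _ FF _ _ tC_inj (fun _ _ => L) (fun x k => (\prod_j v j x k)^-1));
    last by rewrite add0n prednK.
    exact: (dd_cvg_cst FF _ (cvgc_cst FF L)).
  apply: dd_cvgV => //; first by apply: dd_cvg_prod => // j _; exact: v_cvg.
  move=> k ks; have [lv hv] := choice (fun j => v_lim j k ks).
  exists (\prod_j lv j); split; first by apply/prodf_neq0 => j _; have [] := hv j.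
  by apply: (@cvg_prod_fin (R[i])) => j _; have [] := hv j.
exists l; apply: cvg_trans hl; apply: near_eq_cvg.
have c0 : \forall x \near F, forall i, S i -> c x i != 0.
  have : \forall x \near F, forall i : 'I_N, S i -> c x i != 0.
    apply: filter_forall => i; have [Si|Si] := boolP (S i); last exact: nearW.
    have : (w i)%:~R != 0 :> R by rewrite wS // oppr_eq0.
    by move=> /(cvgr_neq0 _ (@c_cvg i)); apply: filterS.
  by [].
apply: filterS2 c0 node_inj => x cx nx.
by rewrite (cluster_sum_dd (i0 := i0)).
Qed.

End ClusterLimit.

Lemma primitive_root_exists (K : closedFieldType) n :
  (n > 0)%N -> (n%:R : K) != 0 -> exists z : K, n.-primitive_root z.
Proof.
move=> n_gt0 nz; have [r Dp] := closed_field_poly_normal ('X^n - 1 : {poly K}).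
move: Dp; rewrite (monicP (monicXnsubC 1 n_gt0)) scale1r => Dp.
have rn1 : all n.-unity_root r.
  by apply/allP => z; rewrite -root_prod_XsubC -Dp.
have sz_r : (n < (size r).+1)%N.
  by rewrite -(size_prod_XsubC r id) -Dp size_XnsubC.
have ur : uniq r by rewrite -separable_prod_XsubC -Dp separable_Xn_sub_1.
by have /hasP[z _ hz] := has_prim_root n_gt0 rn1 ur sz_r; exists z.
Qed.

(** * The filter of deformations and the decomposition into clusters *)

Section Deformation.
Variables (R : realType) (N : nat) (w : 'I_N -> int) (L : R[i]).
Implicit Types (c d : 'I_N -> R).

(** Distinctness is asked only for equal weights: factors of different weights do not meet in the
    limit when x avoids the relevant roots of unity. *)
Definition distinct_cluster_nodes c d := forall i j, negw w i -> negw w j ->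
  w i = w j -> node c d i = node c d j -> i = j.

(* (c, d) tends to (w, 0) while the poles of each cluster stay distinct. *)
Definition deformations : set_system (('I_N -> R) * ('I_N -> R)) :=
  fun P => exists2 e : R, 0 < e & forall c d, distinct_cluster_nodes c d ->
    (forall i, `|c i - (w i)%:~R| < e) -> (forall i, `|d i| < e) -> P (c, d).

Global Instance deformations_filter : Filter deformations.
Proof.
split.
- by exists 1.
- move=> P Q [e e0 he] [e' e'0 he']; exists (Num.min e e').
    by rewrite lt_min e0.
  move=> c d g hc hd; split; [apply: he|apply: he'] => // i.
  + by have := hc i; rewrite lt_min => /andP[].
  + by have := hd i; rewrite lt_min => /andP[].
  + by have := hc i; rewrite lt_min => /andP[].
  + by have := hd i; rewrite lt_min => /andP[].
by move=> P Q PQ [e e0 he]; exists e => // c d g hc hd; apply/PQ/he.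
Qed.

Lemma deformations_near_distinct :
  \forall p \near deformations, distinct_cluster_nodes p.1 p.2.
Proof. by exists 1. Qed.

Lemma deformations_cvg1 i : (fun p => p.1 i) @ deformations --> ((w i)%:~R : R).
Proof.
apply/cvgrPdist_lt => e e0; exists e => // c d _ hc _ /=.
by rewrite distrC.
Qed.

Lemma deformations_cvg2 i : (fun p => p.2 i) @ deformations --> (0 : R).
Proof.
apply/cvgrPdist_lt => e e0; exists e => // c d _ _ hd /=.
by rewrite sub0r normrN.
Qed.

Variable zeta : nat -> R[i].
Hypothesis zeta_prim : forall a, (0 < a)%N -> a.-primitive_root (zeta a).

Definition residue_total c d : R[i] :=
  \sum_(i | negw w i) \sum_(k < `|w i|%N) residue_term w L c d i (zeta `|w i|%N ^+ k).

Definition weight_sum : nat := \sum_i `|w i|%N.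

Lemma weight_le_sum i : (`|w i| <= weight_sum)%N.
Proof. by rewrite /weight_sum (bigD1 i) //= leq_addr. Qed.

(** A cluster is given by a weight -a and a root of unity of order dividing a; [weight_sum] bounds
    a, and a = 0 contributes nothing. *)
Lemma residue_total_clusters c d : residue_total c d =
  \sum_(a < weight_sum.+1) \sum_(k < a) \sum_(i | w i == - (a : nat)%:Z)
    residue_term w L c d i (zeta a ^+ k).
Proof.
rewrite /residue_total (partition_big (fun i => inord `|w i| : 'I_weight_sum.+1) predT) //=.
apply: eq_bigr => a _; rewrite [RHS]exchange_big /=.
have aE i : negw w i && (inord `|w i| == a :> 'I_weight_sum.+1) =
     (w i == - (a : nat)%:Z) && (0 < a)%N.
  rewrite -val_eqE /= inordK ?ltnS ?weight_le_sum // /negw.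
  by apply/andP/andP => -[/= h1 h2]; split; lia.
rewrite (eq_bigl _ _ aE); have [a0|a0] := posnP a.
  rewrite big_pred0 => [|i]; last by rewrite andbF.
  by rewrite big1 // => i _; rewrite big1 // => k _; have := ltn_ord k; rewrite {2}a0.
under [LHS]eq_bigl do rewrite andbT.
apply: eq_bigr => i /eqP wi.
have -> : `|w i|%N = a by rewrite wi abszN.
by [].
Qed.

Hypothesis x_not_unity : forall m, (0 < m <= weight_sum + weight_sum)%N -> cexp L ^+ m != 1.

Lemma cexp_int_neq1 (m : int) : m != 0 -> (`|m| <= weight_sum + weight_sum)%N ->
  cexp L ^ m != 1.
Proof.
move=> m0 mle; have h := x_not_unity (m := `|m|%N); rewrite absz_gt0 m0 mle in h.
case: m m0 mle h => n _ _ h; first exact: h.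
rewrite NegzE -exprnN; apply: contraNneq (h isT) => /eqP.
by rewrite invr_eq1.
Qed.

Lemma cvg_residue_total : L != 0 ->
  exists l, cvgc deformations (fun p => residue_total p.1 p.2) l.
Proof.
move=> L0.
have hl (a : 'I_weight_sum.+1) (k : 'I_a) : exists l, cvgc deformations
   (fun p => \sum_(i | w i == - (a : nat)%:Z) residue_term w L p.1 p.2 i (zeta a ^+ k)) l.
  have a0 : (0 < a)%N by case: k => k /=; lia.
  apply: (@cvg_cluster_sum R N w L a _ a0 _ L0).
  - by rewrite exprAC (prim_expr_order (zeta_prim a0)) expr1n.
  - move=> j Sj; apply/eqP => /eqP; rewrite subr_eq0 => /eqP/esym e.
    have : (zeta a ^+ k) ^ w j * cexp (L * (1 + (w j)%:~R / a%:R)%:C) = 1 := e.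
    (* Raising to the power a removes the root of unity and leaves x^(a + w_j) = 1. The exponent is
       nonzero since j is outside the cluster, and at most twice [weight_sum] in absolute value. *)
    move/(congr1 (fun u => u ^+ a)); rewrite exprMn expr1n.
    rewrite (_ : ((zeta a ^+ k) ^ w j) ^+ a = 1) ?mul1r; last first.
      rewrite exprnP exprzAC -exprnP exprAC (prim_expr_order (zeta_prim a0)).
      by rewrite expr1n exp1rz.
    rewrite -cexpMn (_ : _ *+ a = L *~ (a%:Z + w j)); last first.
      rewrite -[LHS]mulr_natr -[RHS]mulrzr -mulrA; congr (_ * _).
      have -> : (a%:R : R[i]) = (a%:R : R)%:C by rewrite rmorph_nat.
      rewrite -realcM mulrDl mul1r divfK ?pnatr_eq0 -?lt0n //.
      by rewrite -(rmorph_int (real_complex R)) /= intrD.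
    rewrite cexpMz => /eqP; apply/negP; apply: cexp_int_neq1.
      by apply: contra Sj => /eqP ?; apply/eqP; lia.
    by have := ltn_ord a; have := weight_le_sum j; lia.
  - exact: deformations_cvg1.
  - exact: deformations_cvg2.
  apply: filterS deformations_near_distinct => p gp i j.
  rewrite !unfold_in => /eqP wi /eqP wj; apply: gp; rewrite /negw ?wi ?wj //; lia.
have hA (a : 'I_weight_sum.+1) : exists l, cvgc deformations (fun p => \sum_(k < a)
    \sum_(i | w i == - (a : nat)%:Z) residue_term w L p.1 p.2 i (zeta a ^+ k)) l.
  have [l h] := choice (hl a).
  exists (\sum_(k < a) l k).
  by apply: (@cvg_sum_fin (R[i])) => k _; exact: h.
have [l h] := choice hA; exists (\sum_(a < weight_sum.+1) l a).
apply: cvgc_ext (@cvg_sum_fin (R[i]) _ _ _ _ _ _ _ _ (fun a _ => h a)) => [p|//].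
by rewrite residue_total_clusters.
Qed.

End Deformation.

(** * The limit of the residue sum *)

Section Path.
Variables (R : realType).

Lemma cvgc_horner (T : Type) (F : set_system T) (FF : Filter F) (P : {poly R[i]})
    (f : T -> R[i]) (l : R[i]) : cvgc F f l -> cvgc F (fun x => P.[f x]) P.[l].
Proof.
move=> fl; elim/poly_ind: P => [|P c IH].
  apply: cvgc_ext (cvgc_cst FF 0) => [x|]; by rewrite horner0.
apply: cvgc_ext (@cvgD _ (R[i])^o _ _ _ _ _ _ _ (cvgcM FF IH fl) (cvgc_cst FF c)) => [x|].
  by rewrite !hornerE.
by rewrite !hornerE.
Qed.

(** With g = a + ib and |b h| < pi, a value 1 makes sin (b h) vanish, hence b h = 0, and then a h =
    0 by injectivity of [expR]. *)
Lemma cexp_line_neq1 (g : R[i]) : g != 0 ->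
  \forall h \near (0 : R)^', cexp (g * h%:C) != 1.
Proof.
case: g => [a b] g0.
near=> h.
have h0 : h != 0 by near: h; exact: nbhs_dnbhs_neq.
have b1 : 0 < `|b| + 1 by rewrite ltr_wpDl.
have hb : `|b * h| < pi.
  near: h; apply: nbhs_dnbhs; exists (pi / (`|b| + 1)) => /=.
    by rewrite divr_gt0 ?pi_gt0.
  move=> h /=; rewrite sub0r normrN ltr_pdivlMr // => hh; rewrite normrM.
  by apply: le_lt_trans hh; rewrite mulrDr mulr1 mulrC lerDl.
apply/eqP => e.
have [e1 e2] : expR (a * h) * cos (b * h) = 1 /\ expR (a * h) * sin (b * h) = 0.
  by move: e; rewrite /cexp; simpc => /= -[].
have s0 : sin (b * h) = 0.
  by move/eqP: e2; rewrite mulf_eq0 gt_eqF ?expR_gt0 //= => /eqP.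
have bh0 : b * h = 0.
  apply/eqP; apply: contraT => nz.
  have : 0 < sin `|b * h|.
    by apply: sin_gt0_pi; rewrite normr_gt0 nz hb.
  by case: (ger0P (b * h)) => _; rewrite ?sinN s0 ?oppr0 ltxx.
move: e1; rewrite bh0 cos0 mulr1 -[1]expR0 => /expR_inj/eqP.
move/eqP: bh0; rewrite !mulf_eq0 (negbTE h0) !orbF => /eqP b0 /eqP a0.
by move: g0; rewrite a0 b0 eqxx.
Unshelve. all: by end_near.
Qed.

Variables (N : nat) (w : 'I_N -> int) (L : R[i]).
Let x := cexp L.
Variable zeta : nat -> R[i].
Hypothesis zeta_prim : forall a, (0 < a)%N -> a.-primitive_root (zeta a).
Hypothesis x_not_unity :
  forall m, (0 < m <= weight_sum w + weight_sum w)%N -> x ^+ m != 1.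
Hypothesis L_neq0 : L != 0.

Definition path_c (i : 'I_N) : R := (w i)%:~R.
Definition path_d (h : R) (i : 'I_N) : R := h * i%:R.

Lemma path_deformations : (fun h => (path_c, path_d h)) @ (0 : R)^' --> deformations w.
Proof.
move=> P [e e0 he].
suff : \forall h \near (0 : R)^', P (path_c, path_d h) by [].
near=> h.
have h0 : h != 0 by near: h; exact: nbhs_dnbhs_neq.
have hN : `|h| < e / N.+1%:R.
  near: h; apply: nbhs_dnbhs; exists (e / N.+1%:R) => /=; first by rewrite divr_gt0.
  by move=> h /=; rewrite sub0r normrN.
apply: he => [i j wi wj ij|i|i].
- rewrite /node /path_c ij => /(mulIf _); rewrite invr_eq0 intr_eq0.
  move=> /(_ (ltr0_neq0 wj))/oppr_inj/addrI/(mulfI h0)/eqP.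
  by rewrite eqr_nat => /eqP/val_inj.
- by rewrite subrr normr0.
rewrite /path_d normrM normr_nat; apply: le_lt_trans (_ : `|h| * N.+1%:R < e).
  by rewrite ler_wpM2l // ler_nat; have := ltn_ord i; lia.
by rewrite -ltr_pdivlMr.
Unshelve. all: by end_near.
Qed.

Lemma dnbhs0_cvg : (fun h : R => h) @ (0 : R)^' --> (0 : R).
Proof. by move=> P; exact: nbhs_dnbhs. Qed.

Lemma path_node h i : negw w i ->
  node path_c (path_d h) i = (1 + h * i%:R) / `|w i|%:R.
Proof.
move=> wi; have e : (w i)%:~R = - (`|w i|%N)%:R :> R.
  have e0 : w i = - (`|w i|%N)%:Z by rewrite ltz0_abs ?opprK.
  by rewrite {1}e0 mulrNz.
by rewrite /node /path_c /path_d e invrN mulrNN.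
Qed.

Lemma path_root h i : negw w i ->
  cexp (L * (node path_c (path_d h) i)%:C) ^+ `|w i| = cexp (L * (1 + h * i%:R)%:C).
Proof.
move=> wi; rewrite path_node // -cexpMn -mulrnAr -(raddfMn (real_complex R)) /=.
rewrite -[_ *+ `|w i|]mulr_natr divfK //.
by rewrite pnatr_eq0 -lt0n negw_absz_gt0.
Qed.

Lemma path_nodes_injective : \forall h \near (0 : R)^',
  forall i i' k k', negw w i -> negw w i' ->
    zeta `|w i| ^+ k * cexp (L * (node path_c (path_d h) i)%:C) =
    zeta `|w i'| ^+ k' * cexp (L * (node path_c (path_d h) i')%:C) -> i = i'.
Proof.
have : \forall h \near (0 : R)^', forall i i' : 'I_N, negw w i -> negw w i' -> i != i' ->
   cexp (L * (`|w i'|%:R - `|w i|%:R)%:C +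
      L * (i%:R * `|w i'|%:R - i'%:R * `|w i|%:R)%:C * h%:C) != 1.
  apply: filter_forall => i; apply: filter_forall => i'.
  have [wi|wi] := boolP (negw w i); last by apply: nearW => h.
  have [wi'|wi'] := boolP (negw w i'); last by apply: nearW => h.
  have [ii'|ii'] := eqVneq i i'; first by apply: nearW => h.
  have [ww|ww] := eqVneq `|w i|%N `|w i'|%N.
    have g0 : L * (i%:R * `|w i'|%:R - i'%:R * `|w i'|%:R)%:C != 0.
      rewrite mulf_neq0 // realc_eq0 -mulrBl mulf_neq0 //.
        by rewrite subr_eq0 eqr_nat.
      by rewrite pnatr_eq0 -lt0n negw_absz_gt0.
    apply: filterS (cexp_line_neq1 g0) => h hh _ _ _.
    by rewrite ww [(_ - `|w i'|%:R)%:C]realcB subrr mulr0 add0r.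
  set g := L * (_ - i'%:R * _)%:C.
  have lim : cvgc (0 : R)^' (fun h : R => cexp (L * (`|w i'|%:R - `|w i|%:R)%:C + g * h%:C))
      (cexp (L * (`|w i'|%:R - `|w i|%:R)%:C + g * 0%:C)).
    apply: cvg_cexp; apply: cvgcD; first exact: cvgc_cst.
    by apply: cvgcM; [exact: cvgc_cst|exact: cvg_real_complex dnbhs0_cvg].
  suff nz : cexp (L * (`|w i'|%:R - `|w i|%:R)%:C + g * 0%:C) != 1.
    by apply: filterS (cvgc_near_neq _ lim nz) => h hh _ _ _.
  rewrite mulr0 addr0.
  have -> : L * (`|w i'|%:R - `|w i|%:R)%:C = L *~ (`|w i'|%N%:Z - `|w i|%N%:Z).
    by rewrite -[RHS]mulrzr -(rmorph_int (real_complex R)) /= mulrzBr.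
  rewrite cexpMz; apply: (cexp_int_neq1 x_not_unity).
    by rewrite subr_eq0 eq_sym eqz_nat.
  by have := weight_le_sum w i; have := weight_le_sum w i'; lia.
apply: filterS => h hh i i' k k' wi wi' e; apply/eqP; apply: contraT => ii'.
have /eqP := hh i i' wi wi' ii'; case.
have key j m : negw w j -> (zeta `|w j| ^+ m * cexp (L * (node path_c (path_d h) j)%:C))
    ^+ `|w j| = cexp (L * (1 + h * j%:R)%:C).
  move=> wj; rewrite exprMn path_root // exprAC.
  by rewrite (prim_expr_order (zeta_prim (negw_absz_gt0 wj))) expr1n mul1r.
have : cexp (L * (1 + h * i%:R)%:C) ^+ `|w i'| = cexp (L * (1 + h * i'%:R)%:C) ^+ `|w i|.
  by rewrite -(key i k) // -(key i' k') // -!exprM e mulnC.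
rewrite -!cexpMn => e'.
have : cexp (L * (1 + h * i%:R)%:C *+ `|w i'| - L * (1 + h * i'%:R)%:C *+ `|w i|) = 1.
  by rewrite cexpD cexpN e' divff // cexp_neq0.
move=> <-; congr cexp; rewrite -!mulrnAr -mulrBr -mulrA -mulrDr; congr (_ * _).
rewrite -!(raddfMn (real_complex R)) -realcM -realcD -realcB; congr (_%:C).
by rewrite -[X in _ = X - _]mulr_natr -[X in _ = _ - X]mulr_natr; ring.
Qed.

(* The limit exists by cvg_residue_total, so it can be computed along the path
   c = w, d_i = h * i, on which residue_total is the sum of generating_function for
   o = cexp (L * h). *)
Lemma residue_total_limit (v : {poly {poly R[i]}}) : (0 < tdeg w)%N ->
  (forall (x o : R[i]) (e z : 'I_N -> R[i]),
    let y (i : 'I_N) := x * o ^+ i in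
    (forall i, negw w i -> (`|w i|%N).-primitive_root (z i)) ->
    (forall i, negw w i -> e i != 0) ->
    (forall i, negw w i -> e i ^+ `|w i|%N = y i) ->
    (forall i i' k k', negw w i -> negw w i' ->
       z i ^+ k * e i = z i' ^+ k' * e i' -> i = i') ->
    qden w y != 0 ->
    v.[o%:P].[x] / qden w y = \sum_(i | negw w i) \sum_(k < `|w i|%N)
      1 / ((`|w i|%N)%:R * \prod_(j | j != i) (1 - y j * (z i ^+ k * e i) ^ (w j)))) ->
  cvgc (deformations w) (fun p => residue_total w L zeta p.1 p.2)
    (v.[1].[x] / (qgen R[i] w).[x]).
Proof.
move=> d0 hv.
have [l hl] := cvg_residue_total zeta_prim x_not_unity L_neq0.
suff -> : v.[1].[x] / (qgen R[i] w).[x] = l by [].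
have FF0 : Filter (0 : R)^' by typeclasses eauto.
pose Y (i : 'I_N) : {poly {poly R[i]}} := 'X%:P * 'X^i.
pose o (h : R) := cexp (L * h%:C).
have o_cvg : cvgc (0 : R)^' o 1.
  rewrite -(cexp0 R) -[X in cexp X](mulr0 L); apply: cvg_cexp; apply: cvgcM.
    exact: cvgc_cst.
  exact: cvg_real_complex dnbhs0_cvg.
have hc (P : {poly {poly R[i]}}) : cvgc (0 : R)^' (fun h => P.[(o h)%:P].[x]) P.[1].[x].
  have E t : P.[t%:P].[x] = (map_poly (horner_eval x) P).[t].
    by rewrite -[_.[x]]/(horner_eval x _) -horner_map /= /horner_eval hornerC.
  have := @cvgc_horner _ _ FF0 (map_poly (horner_eval x) P) _ _ o_cvg.
  rewrite -E polyC1; apply: cvgc_ext => [h|//].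
  by rewrite -E.
have qY t : (qden w Y).[t%:P].[x] = qden w (fun i => x * t ^+ i).
  have gY i : (horner_eval x \o horner_eval t%:P) (Y i) = x * t ^+ i.
    by rewrite /= /horner_eval !hornerE.
  exact: (map_qden w gY).
have q1 : (qden w Y).[1].[x] = (qgen R[i] w).[x].
  by rewrite -polyC1 qY horner_qgen; apply: eq_bigr => j _;
    apply: eq_bigr => i _; rewrite !expr1n !mulr1.
have qnz : (qgen R[i] w).[x] != 0.
  rewrite horner_qgen; apply/prodf_neq0 => j _; apply/prodf_neq0 => i wi.
  rewrite subr_eq0 eq_sym -exprD; apply: x_not_unity.
  rewrite ltn_addr ?negw_absz_gt0 //=.
  by rewrite leq_add ?weight_le_sum.
have hq : cvgc (0 : R)^' (fun h => (qden w Y).[(o h)%:P].[x]) (qgen R[i] w).[x].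
  by rewrite -q1; exact: hc.
have lim1 := cvgcM FF0 (hc v) (cvgcV FF0 qnz hq).
have lim2 : cvgc (0 : R)^' (fun h => residue_total w L zeta path_c (path_d h)) l.
  exact: cvg_comp path_deformations hl.
(* On the path x o^i = exp(L (1 + h i)), and exp(L node_i) is a |w_i|-th root of it, as the residue
   formula requires. *)
have ev : \forall h \near (0 : R)^', v.[(o h)%:P].[x] / (qden w Y).[(o h)%:P].[x] =
    residue_total w L zeta path_c (path_d h).
  have qn := cvgc_near_neq FF0 hq qnz.
  apply: filterS2 qn path_nodes_injective => h; rewrite qY => qn hinj.
  have yE i : x * o h ^+ i = cexp (L * (1 + h * i%:R)%:C).
    rewrite -cexpMn -cexpD; congr cexp.
    rewrite [in RHS]realcD mulrDr mulr1 -mulrnAr -(raddfMn (real_complex R)) /=.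
    by rewrite -[h *+ i]mulr_natr.
  rewrite (hv x (o h) (fun i => cexp (L * (node path_c (path_d h) i)%:C))
     (fun i => zeta `|w i|)) //; last first.
  - by move=> i wi; rewrite path_root // yE.
  - by move=> i wi; exact: cexp_neq0.
  - by move=> i wi; apply: zeta_prim; exact: negw_absz_gt0.
  rewrite /residue_total; apply: eq_bigr => i wi; apply: eq_bigr => k _.
  rewrite /residue_term; congr (1 / (_ * _)).
    rewrite /path_c -rmorphN /= -ltz0_abs //.
    by rewrite -pmulrn rmorph_nat.
  apply: eq_bigr => j _; congr (1 - _).
  rewrite expfzMl mulrCA; congr (_ * _).
  rewrite yE -cexpMz -cexpD; congr cexp.
  rewrite -mulrzr -mulrA -mulrDr; congr (_ * _).
  rewrite -(rmorph_int (real_complex R)) /= -realcM -realcD.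
  by rewrite [node _ _ _ * _]mulrC.
have lim3 : cvgc (0 : R)^' (fun h => residue_total w L zeta path_c (path_d h))
    (v.[1].[x] / (qgen R[i] w).[x]) := cvg_trans (near_eq_cvg ev) lim1.
exact: (@cvg_unique _ (@norm_hausdorff _ (R[i])^o) _ _ _ _ (lim3 FF0) lim2).
Qed.

End Path.

(** * Polynomials in z and its conjugate *)

Lemma digits_inj B N (f g : 'I_N -> nat) :
  (forall i, f i < B)%N -> (forall i, g i < B)%N ->
  (\sum_i f i * B ^ i = \sum_i g i * B ^ i)%N -> f =1 g.
Proof.
elim: N f g => [|N IH] f g fB gB; first by move=> _ [].
rewrite !big_ord_recl !expn0 !muln1.
have tail (h : 'I_N.+1 -> nat) : (\sum_(i < N) h (lift ord0 i) * B ^ lift ord0 i =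
    (\sum_(i < N) h (lift ord0 i) * B ^ i) * B)%N.
  rewrite big_distrl /=; apply: eq_bigr => i _.
  by rewrite /bump /= add1n expnSr mulnA.
rewrite !tail => e.
have B0 : (0 < B)%N by apply: leq_ltn_trans (fB ord0).
have e0 : f ord0 = g ord0.
  have := congr1 (modn^~ B) e; rewrite /= ![(_ + _ * B)%N]addnC !modnMDl.
  by rewrite !modn_small.
have {}e : f \o lift ord0 =1 g \o lift ord0.
  apply: IH => [i|i|]; rewrite ?fB ?gB //=.
  by move/eqP: e; rewrite e0 eqn_add2l eqn_pmul2r // => /eqP.
move=> i; case: (unliftP ord0 i) => [j ->|->]; last exact: e0.
exact: e.
Qed.

Section Vanishing.
Variables (K : numDomainType) (N : nat).
Implicit Types (P : mpoly N K).

Lemma mpoly_nat_eq0 P : (forall v : 'I_N -> nat, meval (fun i => (v i)%:R) P = 0) -> P = 0.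
Proof.
move=> P0; apply/eqP; apply: contraT => nz.
pose B := msize P; pose code (m : multinom N) := (\sum_i m i * B ^ i)%N.
have codeI : {in msupp P &, injective code}.
  move=> m m' mP m'P e; apply/mnmP; apply: (digits_inj _ _ e) => i.
    apply: leq_ltn_trans (msize_mdeg_lt mP); rewrite mdegE (bigD1 i) //=.
    exact: leq_addr.
  apply: leq_ltn_trans (msize_mdeg_lt m'P); rewrite mdegE (bigD1 i) //=.
  exact: leq_addr.
(* Kronecker substitution X_i = k ^ (B ^ i) *)
pose u : {poly K} := \sum_(m <- msupp P) mcoeff m P *: 'X^(code m).
have u0 (k : nat) : u.[k%:R] = 0.
  rewrite -(P0 (fun i => (k ^ (B ^ i))%N)) mevalE horner_sum; apply: eq_bigr => m _.
  rewrite !hornerE /code expr_sum; congr (_ * _); apply: eq_bigr => i _.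
  by rewrite natrX -exprM mulnC.
have {}u0 : u = 0.
  apply/eqP; apply: contraT => unz.
  have := @max_poly_roots _ u [seq i%:R | i <- iota 0 (size u)] unz.
  rewrite size_map size_iota ltnn; apply.
    by apply/allP => _ /mapP[k _ ->]; apply/rootP.
  by rewrite map_inj_uniq ?iota_uniq // => i j /eqP; rewrite eqr_nat => /eqP.
have [m mP] : exists m, m \in msupp P.
  case E : (msupp P) => [|m s]; last by exists m; rewrite mem_head.
  by move: nz; rewrite -msupp_eq0 E.
have := congr1 (fun p : {poly K} => p`_(code m)) u0.
rewrite coef0 coef_sum (bigD1_seq m) ?msupp_uniq //= coefZ coefXn eqxx mulr1.
rewrite big_seq_cond big1 ?addr0 => [|m' /andP[m'P mm']].
  by move/eqP; rewrite mcoeff_eq0 mP.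
rewrite coefZ coefXn; case: eqP => [e|]; last by rewrite mulr0.
by move: mm'; rewrite (codeI _ _ mP m'P e) eqxx.
Qed.

(** The substitution of u_i X_i for X_i. Monomials are its eigenvectors, so conditions on degrees
    and weights in the support become eigenvalue equations, which can be checked on values and pass
    to factors of a product. *)
Definition mscale (u : 'I_N -> K) P : mpoly N K :=
  \sum_(m <- msupp P) (mcoeff m P * \prod_i u i ^+ m i) *: mpolyX K m.

Lemma mcoeff_mscale u P m : mcoeff m (mscale u P) = mcoeff m P * \prod_i u i ^+ m i.
Proof.
rewrite /mscale raddf_sum /=.
have [mP|mP] := boolP (m \in msupp P).
  rewrite (bigD1_seq m) ?msupp_uniq //= mcoeffZ mcoeffX eqxx mulr1.
  rewrite [X in _ + X]big1 ?addr0 // => m' mm'.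
  by rewrite mcoeffZ mcoeffX (negbTE mm') mulr0.
rewrite big_seq [LHS]big1 => [|m' m'P].
  by move: mP; rewrite -mcoeff_eq0 => /eqP ->; rewrite mul0r.
rewrite mcoeffZ mcoeffX; case: eqP => [e|]; last by rewrite mulr0.
by move: mP; rewrite -e m'P.
Qed.

Lemma meval_mscale u v P : meval v (mscale u P) = meval (fun i => u i * v i) P.
Proof.
rewrite /mscale raddf_sum mevalE; apply: eq_bigr => m _ /=.
rewrite mevalZ mevalX -mulrA -big_split /=; congr (_ * _).
by apply: eq_bigr => i _; rewrite exprMn.
Qed.

End Vanishing.

Section DegreeScaling.
Variables (F : numDomainType) (N : nat).
Implicit Types (P : mpoly N F).

Lemma mscale2_degree P d :
  mscale (fun=> 2) P = 2 ^+ d *: P <-> (forall m, mcoeff m P != 0 -> mdeg m = d).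
Proof.
have E (m : multinom N) : \prod_(i < N) (2 : F) ^+ m i = 2 ^+ mdeg m by rewrite mdegE expr_sum.
split=> [h m nz|h].
  have /eqP := congr1 (mcoeff m) h; rewrite mcoeff_mscale mcoeffZ E mulrC.
  rewrite (inj_eq (mulIf nz)) -!natrX eqr_nat eqn_exp2l // => /eqP.
  by [].
apply/mpolyP => m; rewrite mcoeff_mscale mcoeffZ E.
have [->|/h ->] := eqVneq (mcoeff m P) 0; first by rewrite mul0r mulr0.
by rewrite mulrC.
Qed.

Lemma homog_coeffP P d : P \is ishomog1 d mdeg <-> (forall m, mcoeff m P != 0 -> mdeg m = d).
Proof.
split=> [/dhomogP h m|h]; first by rewrite -mcoeff_msupp => /h.
by apply/dhomogP => m; rewrite mcoeff_msupp => /h.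
Qed.

End DegreeScaling.

Section ComplexCoordinates.
Variables (R : realType) (n : nat) (A : 'rV[int]_n).
Let N := (n + n)%N.
Local Notation K := R[i].
Let ii : K := 0 +i* 1.
Implicit Types (P Q : mpoly N K) (p q : realPoly R n) (z : 'rV[K]_n).

(* In complexified polynomials the variable lshift n j is z_j and rshift n j is its
   conjugate. *)
Definition zconj z : 'I_N -> K := fun k => match fintype.split k with
  | inl j => z 0 j | inr j => (z 0 j)^* end.

Definition coord_weight (k : 'I_N) : int := match fintype.split k with
  | inl j => A 0 j | inr j => - A 0 j end.

Lemma split_lshift (j : 'I_n) : fintype.split (lshift n j) = inl j :> 'I_n + 'I_n.
Proof. by case: splitP => k /= e; [congr inl; exact/val_inj|have := ltn_ord j; lia]. Qed.

Lemma split_rshift (j : 'I_n) : fintype.split (rshift n j) = inr j :> 'I_n + 'I_n.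
Proof. by case: splitP => k /= e; [have := ltn_ord k; lia|congr inr; apply/val_inj => /=; lia]. Qed.

Lemma ord_shift_ind (T : 'I_N -> Prop) :
  (forall j, T (lshift n j)) -> (forall j, T (rshift n j)) -> forall k, T k.
Proof. by move=> hl hr k; rewrite -(splitK k); case: (fintype.split k). Qed.

Definition complexify_var (k : 'I_N) : mpoly N K := match fintype.split k with
  | inl j => 2^-1 *: (mpolyX K (mnm1 (lshift n j)) + mpolyX K (mnm1 (rshift n j)))
  | inr j => (2 * ii)^-1 *: (mpolyX K (mnm1 (lshift n j)) - mpolyX K (mnm1 (rshift n j))) end.

Lemma meval_mmap (S T : comNzRingType) (f : S -> T) (g : 'I_N -> mpoly N T)
    (s : 'I_N -> T) (p : mpoly N S) :
  meval s (mmap (fun c => @mpolyC N T (f c)) g p) =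
  \sum_(m <- msupp p) f (mcoeff m p) * \prod_i (meval s (g i)) ^+ m i.
Proof.
rewrite /mmap raddf_sum /=; apply: eq_bigr => m _.
rewrite mevalM mevalC /mmap1 rmorph_prod /=; congr (_ * _).
by apply: eq_bigr => i _; rewrite rmorphXn.
Qed.

Lemma meval_realc (v : 'I_N -> R) p :
  (meval v p)%:C = \sum_(m <- msupp p) (mcoeff m p)%:C * \prod_i ((v i)%:C) ^+ m i.
Proof.
rewrite mevalE (rmorph_sum (real_complex R)) /=; apply: eq_bigr => m _.
rewrite rmorphM (rmorph_prod (real_complex R)) /=; congr (_ * _).
by apply: eq_bigr => i _; rewrite rmorphXn.
Qed.

Lemma complexify_subproof p : exists P : mpoly N K,
  forall z, meval (zconj z) P = (meval (real_coords z) p)%:C.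
Proof.
exists (mmap (@mpolyC N K \o real_complex R) complexify_var p) => z.
rewrite meval_mmap meval_realc; apply: eq_bigr => m _; congr (_ * _).
apply: eq_bigr => k _; congr (_ ^+ _).
rewrite /complexify_var /real_coords; case: (fintype.split k) => j.
  rewrite mevalZ mevalD !mevalXU /zconj split_lshift split_rshift.
  by rewrite ReJ_add mulrC.
rewrite mevalZ mevalB !mevalXU /zconj split_lshift split_rshift.
have i0 : ii != 0 by rewrite eq_complex /= oner_eq0 andbF.
apply: (mulfI (_ : 2 * ii != 0)); first by rewrite mulf_neq0 // pnatr_eq0.
rewrite mulVKf ?mulf_neq0 ?pnatr_eq0 //.
by rewrite subcJ mulrAC.
Qed.

(** Only the values are kept. By [conj_poly_inj] they determine the polynomial, so its algebraic
    properties follow by evaluation. *)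
Definition complexify p : mpoly N K := projT1 (cid (complexify_subproof p)).

Lemma meval_complexify z p :
  meval (zconj z) (complexify p) = (meval (real_coords z) p)%:C.
Proof. exact: projT2 (cid (complexify_subproof p)) z. Qed.

(** This makes z and its conjugate independent variables: substituting X + iY and X - iY gives a
    polynomial Q vanishing at natural points, hence zero, and the point s below undoes the
    substitution. *)
Lemma conj_poly_eq0 P : (forall z, meval (zconj z) P = 0) -> P = 0.
Proof.
move=> P0.
pose g (k : 'I_N) : mpoly N K := match fintype.split k with
  | inl j => mpolyX K (mnm1 (lshift n j)) + ii *: mpolyX K (mnm1 (rshift n j))
  | inr j => mpolyX K (mnm1 (lshift n j)) - ii *: mpolyX K (mnm1 (rshift n j)) end.
pose Q := mmap (@mpolyC N K \o id) g P.
have Q0 : Q = 0.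
  apply: mpoly_nat_eq0 => v; rewrite meval_mmap.
  rewrite -[RHS](P0 (\row_j ((v (lshift n j))%:R + ii * (v (rshift n j))%:R))) mevalE.
  apply: eq_bigr => m _; congr (_ * _); apply: eq_bigr => k _; congr (_ ^+ _).
  rewrite /g /zconj; case: (fintype.split k) => j; rewrite !mxE.
    by rewrite mevalD mevalZ !mevalXU.
  rewrite mevalB mevalZ !mevalXU rmorphD rmorphM !rmorph_nat.
  have iiC : ii^* = - ii by apply/eqP; rewrite eq_complex /= oppr0 !eqxx.
  by rewrite -[X in _ + X * _]/(ii^*) iiC mulNr.
apply: mpoly_nat_eq0 => v.
pose s (k : 'I_N) : K := match fintype.split k with
  | inl j => 2^-1 * ((v (lshift n j))%:R + (v (rshift n j))%:R)
  | inr j => (2 * ii)^-1 * ((v (lshift n j))%:R - (v (rshift n j))%:R) end.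
have : meval s Q = 0 by rewrite Q0 meval0.
rewrite meval_mmap => <-; rewrite mevalE; apply: eq_bigr => m _; congr (_ * _).
have two : (2 : K) != 0 by rewrite pnatr_eq0.
have i0 : ii != 0 by rewrite eq_complex /= oner_eq0 andbF.
apply: eq_bigr => k _; congr (_ ^+ _); move: k; apply: ord_shift_ind => j.
  rewrite /g split_lshift mevalD mevalZ !mevalXU /s split_lshift split_rshift.
  by field; rewrite i0.
rewrite /g split_rshift mevalB mevalZ !mevalXU /s split_lshift split_rshift.
by field; rewrite i0.
Qed.

Lemma conj_poly_inj P Q :
  (forall z, meval (zconj z) P = meval (zconj z) Q) -> P = Q.
Proof.
move=> PQ; have e : P - Q = 0.
  by apply: conj_poly_eq0 => z; rewrite mevalB PQ subrr.
exact: subr0_eq e.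
Qed.

Lemma complexifyM p q : complexify (p * q) = complexify p * complexify q.
Proof.
apply: conj_poly_inj => z; rewrite meval_complexify.
transitivity (meval (zconj z) (complexify p) * meval (zconj z) (complexify q)).
  by rewrite !meval_complexify (mevalM (real_coords z) p q) realcM.
by symmetry; exact: mevalM.
Qed.

Lemma complexifyD p q : complexify (p + q) = complexify p + complexify q.
Proof.
apply: conj_poly_inj => z; rewrite meval_complexify.
by rewrite (mevalD (real_coords z) p q) mevalD !meval_complexify realcD.
Qed.

Lemma complexifyZ a p : complexify (a *: p) = a%:C *: complexify p.
Proof.
apply: conj_poly_inj => z; rewrite meval_complexify.
by rewrite (mevalZ (real_coords z) a p) mevalZ !meval_complexify realcM.
Qed.

Lemma complexify_inj p q : complexify p = complexify q -> p = q.
Proof.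
move=> pq; have e : p - q = 0.
  apply: mpoly_nat_eq0 => v; rewrite mevalB.
  pose z : 'rV[K]_n := \row_j ((v (lshift n j))%:R +i* (v (rshift n j))%:R).
  have h r : meval (fun i => (v i)%:R) r = meval (real_coords z) r :> R.
    apply: meval_eq; apply: ord_shift_ind => j.
      by rewrite /real_coords split_lshift mxE.
    by rewrite /real_coords split_rshift mxE.
  apply: (@complexI R); rewrite realcB !h -!meval_complexify pq subrr.
  by [].
exact: subr0_eq e.
Qed.

Lemma complexify_mscale2 p :
  complexify (mscale (fun=> 2) p) = mscale (fun=> 2) (complexify p).
Proof.
apply: conj_poly_inj => z; rewrite meval_complexify !meval_mscale.
rewrite (meval_eq (v2 := zconj (2 *: z))); last first.
  apply: ord_shift_ind => j; rewrite /zconj ?split_lshift ?split_rshift mxE //.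
  by rewrite rmorphM rmorph_nat.
rewrite meval_complexify; congr (_%:C); apply: meval_eq.
by apply: ord_shift_ind => j; rewrite /real_coords ?split_lshift ?split_rshift mxE;
  case: (z 0 j) => a b /=; ring.
Qed.

Lemma complexify_homog p d : p \is ishomog1 d mdeg <->
  (forall m, mcoeff m (complexify p) != 0 -> mdeg m = d).
Proof.
have E : 2 ^+ d *: complexify p = complexify (2 ^+ d *: p).
  by rewrite complexifyZ; congr (_ *: _); rewrite rmorphXn rmorph_nat.
split=> [/homog_coeffP/mscale2_degree h|/mscale2_degree h].
  by apply/mscale2_degree; rewrite -complexify_mscale2 h E.
apply/homog_coeffP/mscale2_degree/complexify_inj.
by rewrite complexify_mscale2 h E.
Qed.

Definition mweight (m : multinom N) : int := \sum_k coord_weight k * (m k)%:Z.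

Lemma prod_exp_weight (t : K) (m : multinom N) : t != 0 ->
  \prod_i (t ^ coord_weight i) ^+ m i = t ^ mweight m.
Proof.
move=> t0; rewrite /mweight; apply: (big_rec2 (fun a b => a = t ^ b)) => [|i a b _ ->].
  by rewrite expr0z.
by rewrite expfzDr // exprnP -exprz_exp.
Qed.

Lemma zconj_circle_act t z k : `|t| = 1 ->
  zconj (circle_act A t z) k = t ^ coord_weight k * zconj z k.
Proof.
move=> t1; move: k; apply: ord_shift_ind => j; rewrite /zconj /coord_weight.
  by rewrite split_lshift mxE.
have tC : t^* = t^-1.
  by rewrite invc_norm t1 expr1n invr1 mul1r.
by rewrite split_rshift mxE rmorphM fmorphXz /= tC exprz_inv.
Qed.

Lemma invariant_weightP p : Defs.invariant A p <->
  (forall m, mcoeff m (complexify p) != 0 -> mweight m = 0).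
Proof.
have E t z : `|t| = 1 -> (meval (real_coords (circle_act A t z)) p)%:C =
    meval (zconj z) (mscale (fun k => t ^ coord_weight k) (complexify p)).
  move=> t1; rewrite meval_mscale -meval_complexify; apply: meval_eq => k.
  exact: zconj_circle_act.
have nz t : `|t| = 1 -> t != 0 :> K by move=> t1; rewrite -normr_eq0 t1 oner_eq0.
split=> [h m pm|h t z t1].
  (* A root of unity whose order exceeds the absolute weight of m detects whether that weight is
     0. *)
  have [t tp] := @primitive_root_exists K `|mweight m|.+1 isT ltac:(by rewrite pnatr_eq0).
  have t1 : `|t| = 1.
    apply/eqP; rewrite -(@pexpr_eq1 _ _ `|mweight m|.+1) // -normrX.
    by rewrite (prim_expr_order tp) normr1.
  have /(congr1 (mcoeff m)) : mscale (fun k => t ^ coord_weight k) (complexify p) = complexify p.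
    by apply: conj_poly_inj => z; rewrite -E // h // meval_complexify.
  rewrite mcoeff_mscale prod_exp_weight ?nz // => /eqP.
  rewrite -[X in _ == X]mulr1 (inj_eq (mulfI pm)) => /eqP e.
  have : t ^+ `|mweight m| = 1.
    by case: (mweight m) e => k //; rewrite NegzE -exprnN => /eqP; rewrite invr_eq1 => /eqP.
  move/eqP; rewrite -(prim_order_dvd tp) => dv; apply/eqP; rewrite -absz_eq0.
  by apply: contraTT dv; rewrite -lt0n => w0; rewrite gtnNdvd.
apply: (@complexI R); rewrite E // -meval_complexify; congr meval.
apply/mpolyP => m; rewrite mcoeff_mscale prod_exp_weight ?nz //.
have [->|/h ->] := eqVneq (mcoeff m (complexify p)) 0; first by rewrite mul0r.
by rewrite expr0z mulr1.
Qed.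

Lemma invariant_of_degreeP p d : invariant_of_degree A d p <->
  (forall m, mcoeff m (complexify p) != 0 -> mweight m = 0 /\ mdeg m = d).
Proof.
split=> [[/invariant_weightP h1 /complexify_homog h2] m nz|h].
  by split; [exact: h1|exact: h2].
by split; [apply/invariant_weightP|apply/complexify_homog] => m /h[].
Qed.

End ComplexCoordinates.

(** * The on-shell Hilbert function *)

Section QuotientDimension.
Variables (F : fieldType) (X : lmodType F).

(** A finite-dimensional subspace given by a predicate, with [c] linear on all of X; the quotient
    then becomes a matter of matrices although X may be infinite-dimensional. *)
Record coordinates (V : X -> Prop) (k : nat) (e : 'I_k -> X) (c : X -> 'rV[F]_k) : Prop :=
  Coordinates {
    coord_linear : forall a p q, c (a *: p + q) = a *: c p + c q;
    coord_comb : forall v : 'rV[F]_k, V (\sum_i v 0 i *: e i);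
    coord_combK : forall v : 'rV[F]_k, c (\sum_i v 0 i *: e i) = v;
    coord_decomp : forall p, V p -> p = \sum_i c p 0 i *: e i }.

Variables (V V' : X -> Prop) (k k' : nat) (e : 'I_k -> X) (e' : 'I_k' -> X).
Variables (c : X -> 'rV[F]_k) (c' : X -> 'rV[F]_k') (mul : X -> X).
Hypothesis V_coord : coordinates V e c.
Hypothesis V'_coord : coordinates V' e' c'.
Hypothesis mul_linear : forall a p q, mul (a *: p + q) = a *: mul p + mul q.
Hypothesis mul_inj : forall p, mul p = 0 -> p = 0.
Hypothesis mul_sub : forall p, V' p -> V (mul p).
Hypothesis mul_saturated : forall p q, V p -> p = mul q -> V' q.

Let comb (v : 'rV[F]_k) := \sum_i v 0 i *: e i.
Let comb' (v : 'rV[F]_k') := \sum_i v 0 i *: e' i.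

Let comb_lin a u v : comb (a *: u + v) = a *: comb u + comb v.
Proof.
rewrite /comb scaler_sumr -big_split /=; apply: eq_bigr => i _.
by rewrite !mxE scalerDl scalerA.
Qed.

Let c0 : c 0 = 0.
Proof. by have := coord_linear V_coord (-1) 0 0; rewrite scaler0 addr0 scaleN1r addNr. Qed.

Let mul0 : mul 0 = 0.
Proof. by have := mul_linear (-1) 0 0; rewrite scaler0 addr0 scaleN1r addNr. Qed.

Let Mx : 'M[F]_(k', k) := \matrix_i c (mul (e' i)).

Let mulMx v : v *m Mx = c (mul (comb' v)).
Proof.
rewrite mulmx_sum_row /comb'.
apply: (big_rec2 (fun a b => a = c (mul b))) => [|i a b _ ->]; first by rewrite mul0 c0.
by rewrite mul_linear (coord_linear V_coord) rowK.
Qed.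

Let idealP p : V p -> (exists q, p = mul q) <-> (c p <= Mx)%MS.
Proof.
move=> Vp; split=> [[q pq]|/submxP[v cv]].
  apply/submxP; exists (c' q); rewrite mulMx.
  have -> : comb' (c' q) = q by rewrite /comb' -(coord_decomp V'_coord (mul_saturated Vp pq)).
  by rewrite -pq.
exists (comb' v); rewrite (coord_decomp V_coord Vp) cv mulMx.
by rewrite -(coord_decomp V_coord) //; apply: mul_sub; exact: coord_comb V'_coord v.
Qed.

Let Mx_free : row_free Mx.
Proof.
apply/inj_row_free => v; rewrite mulMx => cv.
have : mul (comb' v) = 0.
  rewrite (coord_decomp V_coord (mul_sub (coord_comb V'_coord v))) cv.
  by apply: big1 => i _; rewrite mxE scale0r.
move/mul_inj => v0; rewrite -[v](coord_combK V'_coord) -/(comb' v) v0.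
by have := coord_linear V'_coord (-1) 0 0; rewrite scaler0 addr0 scaleN1r addNr.
Qed.

Definition quotient_basis j (b : 'I_j -> X) :=
  (forall i, V (b i)) /\
  (forall p, V p -> exists! a : 'rV[F]_j, exists q, p - \sum_(i < j) a 0 i *: b i = mul q).

Let quotientP j (b : 'I_j -> X) (E : 'M[F]_(j, k)) : (forall i, b i = comb (row i E)) ->
  (forall v : 'rV[F]_k, exists! a : 'rV[F]_j, (v - a *m E <= Mx)%MS) <-> quotient_basis b.
Proof.
move=> bE.
have bs (a : 'rV[F]_j) : \sum_(i < j) a 0 i *: b i = comb (a *m E).
  rewrite mulmx_sum_row.
  apply: (big_rec2 (fun x y => x = comb y)) => [|i x y _ ->].
    by rewrite /comb big1 // => i _; rewrite mxE scale0r.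
  by rewrite bE comb_lin.
have sub p (a : 'rV[F]_j) : V p -> (exists q, p - \sum_(i < j) a 0 i *: b i = mul q) <->
    (c p - a *m E <= Mx)%MS.
  move=> Vp; have -> : p - \sum_(i < j) a 0 i *: b i = comb (c p - a *m E).
    rewrite bs {1}(coord_decomp V_coord Vp) -/(comb _) addrC -scaleN1r -comb_lin.
    by rewrite scaleN1r addrC.
  rewrite idealP; last exact: coord_comb V_coord _.
  by rewrite (coord_combK V_coord).
split=> [h|[Vb h] v].
  split=> [i|p Vp]; first by rewrite bE; exact: coord_comb V_coord _.
  have [a [ha ua]] := h (c p); exists a; split; first exact/sub.
  by move=> a' /(sub _ _ Vp); exact: ua.
have Vv := coord_comb V_coord v; have [a [ha ua]] := h _ Vv.
have cv := coord_combK V_coord v.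
exists a; split; first by move/(sub _ _ Vv): ha; rewrite cv.
by move=> a' ha'; apply/ua/(sub _ _ Vv); rewrite cv.
Qed.

(** The coordinate rows of b together with those of [Mx] form a basis of row space: independence
    comes from uniqueness for the class of 0 and injectivity of [mul], spanning from existence for
    unit rows. *)
Lemma quotient_basis_size j (b : 'I_j -> X) : quotient_basis b -> (j + k' = k)%N.
Proof.
move=> qb; have [Vb _] := qb.
pose E : 'M[F]_(j, k) := \matrix_i c (b i).
have bE i : b i = comb (row i E) by rewrite rowK /comb -(coord_decomp V_coord (Vb i)).
have h := (quotientP bE).2 qb.
have free : row_free (col_mx E Mx).
  apply/inj_row_free => v; rewrite -[v]hsubmxK mul_row_col => e0.
  have [a [ha ua]] := h 0.
  have a0 : lsubmx v = 0.
    rewrite -(ua (lsubmx v)) ?(ua 0) //; first by rewrite sub0r mul0mx oppr0 sub0mx.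
    move/eqP: e0; rewrite addr_eq0 => /eqP ->; rewrite sub0r opprK; exact: submxMl.
  rewrite a0 mul0mx add0r in e0 *.
  have -> : rsubmx v = 0.
    by apply/eqP; rewrite -(mulmx_free_eq0 _ Mx_free) e0.
  by rewrite row_mx0.
have full : row_full (col_mx E Mx).
  rewrite -sub1mx; apply/row_subP => i.
  have [a [/submxP[u hu] _]] := h (row i 1%:M).
  apply/submxP; exists (row_mx a u); rewrite mul_row_col -hu addrC subrK.
  by [].
move: free full; rewrite /row_free /row_full => /eqP -> /eqP.
by [].
Qed.

Lemma quotient_basis_exists : exists j, exists b : 'I_j -> X, quotient_basis b.
Proof.
pose E := row_base (Mx^C)%MS; exists (\rank (Mx^C)%MS), (fun i => comb (row i E)).
apply/(quotientP (fun i => erefl)) => v.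
have : (v <= Mx + Mx^C)%MS by apply: submx_full; exact: addsmx_compl_full.
move=> /sub_addsmxP[[u1 u2] /= vE].
have /submxP[a aE] : (u2 *m (Mx^C)%MS <= E)%MS by rewrite eq_row_base submxMl.
have ha : (v - a *m E <= Mx)%MS by rewrite vE aE addrK submxMl.
exists a; split=> //.
move=> a' ha'.
have d1 : ((a' - a) *m E <= Mx)%MS.
  have -> : (a' - a) *m E = (v - a *m E) + (-1) *: (v - a' *m E).
    by rewrite mulmxBl scaleN1r opprB [RHS]addrC addrA subrK.
  by rewrite addmx_sub // scalemx_sub.
have d2 : ((a' - a) *m E <= Mx^C)%MS.
  by apply: submx_trans (submxMl _ _) _; rewrite eq_row_base.
have : ((a' - a) *m E <= Mx :&: Mx^C)%MS by rewrite sub_capmx d1.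
rewrite capmx_compl submx0 mulmx_free_eq0 ?row_base_free // subr_eq0 => /eqP.
by [].
Qed.

End QuotientDimension.

Section ScaleProduct.
Variables (F : numDomainType) (N : nat).
Implicit Types (P Q : mpoly N F).

Lemma mpoly_nat_inj P Q :
  (forall v : 'I_N -> nat, meval (fun i => (v i)%:R) P = meval (fun i => (v i)%:R) Q) -> P = Q.
Proof.
move=> PQ; have e : P - Q = 0.
  by apply: mpoly_nat_eq0 => v; rewrite mevalB PQ subrr.
exact: subr0_eq e.
Qed.

Lemma mscaleM u P Q : mscale u (P * Q) = mscale u P * mscale u Q.
Proof.
apply: mpoly_nat_inj => v; rewrite meval_mscale.
transitivity (meval (fun i => (v i)%:R) (mscale u P) * meval (fun i => (v i)%:R) (mscale u Q)).
  by rewrite !meval_mscale; exact: mevalM.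
by symmetry; exact: mevalM.
Qed.

Lemma mscale_eigenP u P (a : F) :
  mscale u P = a *: P <-> (forall m, mcoeff m P != 0 -> \prod_i u i ^+ m i = a).
Proof.
split=> [h m nz|h].
  have /eqP := congr1 (mcoeff m) h; rewrite mcoeff_mscale mcoeffZ mulrC.
  by rewrite (inj_eq (mulIf nz)) => /eqP.
apply/mpolyP => m; rewrite mcoeff_mscale mcoeffZ.
have [->|/h ->] := eqVneq (mcoeff m P) 0; first by rewrite mul0r mulr0.
by rewrite mulrC.
Qed.

End ScaleProduct.

(** * The real structure and monomial coordinates of real polynomials *)

Section Coordinates.
Variables (R : realType) (n : nat) (A : 'rV[int]_n).
Let N := (n + n)%N.
Local Notation K := R[i].
Let ii : K := 0 +i* 1.
Implicit Types (P Q : mpoly N K) (p q : realPoly R n) (z : 'rV[K]_n) (m : multinom N).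

Definition swap_index (k : 'I_N) : 'I_N := match fintype.split k with
  | inl j => rshift n j | inr j => lshift n j end.

Lemma swap_indexK : involutive swap_index.
Proof. by apply: ord_shift_ind => j; rewrite /swap_index !(split_lshift, split_rshift). Qed.

Definition mswap m : multinom N := Multinom [tuple m (swap_index k) | k < N].

Lemma mswapE m k : mswap m k = m (swap_index k).
Proof. exact: mnmE. Qed.

Lemma mswapK : involutive mswap.
Proof. by move=> m; apply/mnmP => k; rewrite !mswapE swap_indexK. Qed.

Lemma zconj_swap z k : zconj z (swap_index k) = (zconj z k)^*.
Proof.
move: k; apply: ord_shift_ind => j; rewrite /swap_index /zconj.
  by rewrite !(split_lshift, split_rshift).
by rewrite !(split_lshift, split_rshift) conjcK.
Qed.

Lemma mweight_swap m : mweight A (mswap m) = - mweight A m.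
Proof.
rewrite /mweight (reindex_inj (inv_inj swap_indexK)) /= -sumrN; apply: eq_bigr => k _.
rewrite mswapE swap_indexK -mulNr; congr (_ * _).
by move: k; apply: ord_shift_ind => j; rewrite /swap_index /coord_weight
  !(split_lshift, split_rshift) ?opprK.
Qed.

Lemma mdeg_swap m : mdeg (mswap m) = mdeg m.
Proof.
rewrite !mdegE (reindex_inj (inv_inj swap_indexK)) /=; apply: eq_bigr => k _.
by rewrite mswapE swap_indexK.
Qed.

Lemma prod_zconj_swap z m : \prod_k zconj z k ^+ mswap m k = (\prod_k zconj z k ^+ m k)^*.
Proof.
rewrite rmorph_prod (reindex_inj (inv_inj swap_indexK)) /=; apply: eq_bigr => k _.
by rewrite mswapE swap_indexK zconj_swap rmorphXn.
Qed.

(** The values of p are real, hence fixed by conjugation, and conjugation exchanges the two halves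
    of the variables. *)
Lemma mcoeff_complexify_swap p m :
  mcoeff (mswap m) (complexify p) = (mcoeff m (complexify p))^*.
Proof.
set P := complexify p.
pose Q : mpoly N K := \sum_(m <- msupp P) (mcoeff m P)^* *: mpolyX K (mswap m).
have PQ : P = Q.
  apply: conj_poly_inj => z; rewrite meval_complexify -(conjc_real (meval _ p)).
  rewrite -meval_complexify -/P mevalE /Q !raddf_sum /=; apply: eq_bigr => m' _.
  by rewrite mevalZ mevalX prod_zconj_swap rmorphM.
rewrite {1}PQ /Q raddf_sum /=.
have [mP|mP] := boolP (m \in msupp P).
  rewrite (bigD1_seq m) ?msupp_uniq //= mcoeffZ mcoeffX eqxx mulr1.
  rewrite [X in _ + X]big1 ?addr0 // => m' mm'.
  by rewrite mcoeffZ mcoeffX (inj_eq (inv_inj mswapK)) (negbTE mm') mulr0.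
rewrite big_seq [LHS]big1 => [|m' m'P].
  by move: mP; rewrite -mcoeff_eq0 => /eqP ->; rewrite conjc0.
rewrite mcoeffZ mcoeffX (inj_eq (inv_inj mswapK)); case: eqP => [e|]; last by rewrite mulr0.
by move: mP; rewrite -e m'P.
Qed.

Lemma complexify_surj P : (forall z, Im (meval (zconj z) P) = 0) ->
  exists p, complexify p = P.
Proof.
move=> PI.
pose g (k : 'I_N) : mpoly N K := match fintype.split k with
  | inl j => mpolyX K (mnm1 (lshift n j)) + ii *: mpolyX K (mnm1 (rshift n j))
  | inr j => mpolyX K (mnm1 (lshift n j)) - ii *: mpolyX K (mnm1 (rshift n j)) end.
pose Q := mmap (@mpolyC N K \o id) g P.
have Qe z : meval (fun k => (real_coords z k)%:C) Q = meval (zconj z) P.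
  rewrite meval_mmap mevalE; apply: eq_bigr => m _; congr (_ * _).
  apply: eq_bigr => k _; congr (_ ^+ _); move: k; apply: ord_shift_ind => j.
    rewrite /g split_lshift mevalD mevalZ !mevalXU /real_coords /zconj split_lshift split_rshift.
    by rewrite -complexE.
  rewrite /g split_rshift mevalB mevalZ !mevalXU /real_coords /zconj split_lshift split_rshift.
  by case: (z 0 j) => a b; rewrite /ii; simpc.
exists (\sum_(m <- msupp Q) Re (mcoeff m Q) *: mpolyX R m).
apply: conj_poly_inj => z; rewrite meval_complexify.
have -> : meval (zconj z) P = (Re (meval (zconj z) P))%:C.
  by rewrite [LHS]complexE PI mulr0 addr0.
rewrite -Qe; congr (_%:C).
rewrite (mevalE (fun k => (real_coords z k)%:C) Q) (raddf_sum (meval (real_coords z))).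
rewrite [RHS]raddf_sum; apply: eq_bigr => m _ /=.
rewrite mevalZ mevalX (_ : \prod_i _ = (\prod_i real_coords z i ^+ m i)%:C).
  by case: (mcoeff m Q) => a b; rewrite /= mulr0 subr0.
rewrite (rmorph_prod (real_complex R)) /=; apply: eq_bigr => k _.
by rewrite rmorphXn.
Qed.

(* For a coefficient c of m, and c^* of its swap, the coordinates on the polynomials
   below at m and at its swap are Re c + Im c and Re c - Im c. *)
Lemma real_basis m : exists p, complexify p =
  ((1 + ii) / 2) *: mpolyX K m + ((1 - ii) / 2) *: mpolyX K (mswap m).
Proof.
apply: complexify_surj => z; rewrite mevalD !mevalZ !mevalX prod_zconj_swap.
case: (\prod_i _) => a b; rewrite /ii -(rmorph_nat (real_complex R) 2) -realcV.
simpc => /=; ring.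
Qed.

(** There is one such polynomial per monomial, without a choice inside pairs exchanged by [mswap],
    so real dimensions are numbers of monomials. When m is its own swap the two halves add up to m
    itself. *)
Definition real_monomial m : realPoly R n := projT1 (cid (real_basis m)).

Lemma complexify_real_monomial m : complexify (real_monomial m) =
  ((1 + ii) / 2) *: mpolyX K m + ((1 - ii) / 2) *: mpolyX K (mswap m).
Proof. exact: projT2 (cid (real_basis m)). Qed.

Definition real_coord m p : R := Re (mcoeff m (complexify p)) + Im (mcoeff m (complexify p)).

Lemma real_coord_linear m a p q :
  real_coord m (a *: p + q) = a * real_coord m p + real_coord m q.
Proof.
rewrite /real_coord complexifyD complexifyZ mcoeffD mcoeffZ !raddfD /=.
by case: (mcoeff m _) => u v; rewrite Re_real_mul Im_real_mul /= mulrDr addrACA.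
Qed.

Lemma real_coord_monomial m m' : real_coord m' (real_monomial m) = (m == m')%:R.
Proof.
rewrite /real_coord complexify_real_monomial mcoeffD !mcoeffZ !mcoeffX.
have h : (2 : K)^-1 = (2^-1 : R)%:C by rewrite realcV rmorph_nat.
rewrite h /ii; case: (m == m'); case: (mswap m == m'); simpc => /=; by field.
Qed.

Lemma complexify0 : complexify (0 : realPoly R n) = 0.
Proof. by rewrite -(scale0r (0 : realPoly R n)) complexifyZ scale0r. Qed.

Lemma real_coord_eq0 p : (forall m, mcoeff m (complexify p) != 0 -> real_coord m p = 0) -> p = 0.
Proof.
move=> h; apply: complexify_inj; rewrite complexify0; apply/mpolyP => m; rewrite mcoeff0.
apply/eqP; apply: contraT => nz.
have nz' : mcoeff (mswap m) (complexify p) != 0.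
  by rewrite mcoeff_complexify_swap conjc_eq0.
have := h _ nz'; have := h _ nz; rewrite /real_coord mcoeff_complexify_swap.
move: nz; case: (mcoeff m _) => a b nz /= e1 e2.
have a0 : a = 0 by lra.
have b0 : b = 0 by lra.
by move: nz; rewrite a0 b0 eqxx.
Qed.

Section SupportSpace.
Variables (M : nat) (S : pred (multinom N)).
Hypothesis S_swap : forall m, S m -> S (mswap m).
Hypothesis S_bound : forall m, S m -> (mdeg m < M)%N.

Definition supported p := forall m, mcoeff m (complexify p) != 0 -> S m.

Definition mfun (f : {ffun 'I_N -> 'I_M}) : multinom N := Multinom [tuple (f k : nat) | k < N].

Lemma mfunE f k : mfun f k = f k. Proof. exact: mnmE. Qed.

Definition support_set : {set {ffun 'I_N -> 'I_M}} := [set f | S (mfun f)]%SET.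

Let mi (i : 'I_#|support_set|) := mfun (enum_val i).

Lemma mfun_inj : injective mfun.
Proof.
by move=> f g e; apply/ffunP => k; apply/val_inj; rewrite /= -!mfunE e.
Qed.

Lemma mfun_surj m : S m -> exists i, mi i = m.
Proof.
move=> Sm; have mM k : (m k < M)%N.
  by apply: leq_ltn_trans (S_bound Sm); rewrite mdegE (bigD1 k) //= leq_addr.
pose f := [ffun k => Ordinal (mM k)].
have fm : mfun f = m by apply/mnmP => k; rewrite mfunE ffunE.
have fS : f \in support_set by rewrite inE fm.
by exists (enum_rank_in fS f); rewrite /mi enum_rankK_in.
Qed.

Lemma support_coordinates : coordinates supported
  (fun i => real_monomial (mi i)) (fun p => \row_i real_coord (mi i) p).
Proof.
have lin a p q : supported p -> supported q -> supported (a *: p + q).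
  move=> hp hq m; rewrite complexifyD complexifyZ mcoeffD mcoeffZ => nz.
  have [p0|/hp //] := eqVneq (mcoeff m (complexify p)) 0.
  by apply: hq; move: nz; rewrite p0 mulr0 add0r.
have mono i : supported (real_monomial (mi i)).
  have Si : S (mi i) by have := enum_valP i; rewrite inE.
  move=> m; rewrite complexify_real_monomial mcoeffD !mcoeffZ !mcoeffX.
  have [<- //|_] := eqVneq (mi i) m.
  have [<- _|_] := eqVneq (mswap (mi i)) m; first exact: S_swap.
  by rewrite !mulr0 addr0 eqxx.
have s0 : supported 0 by move=> m; rewrite complexify0 mcoeff0 eqxx.
have comb (v : 'rV[R]_#|support_set|) : supported (\sum_i v 0 i *: real_monomial (mi i)).
  by apply: (big_ind (fun p => supported p)) => // [p q hp hq|i _];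
    [rewrite -[p]scale1r|rewrite -[_ *: _]addr0]; exact: lin.
have rc0 m : real_coord m 0 = 0.
  by rewrite /real_coord complexify0 mcoeff0 /= addr0.
have combK (v : 'rV[R]_#|support_set|) :
    \row_i real_coord (mi i) (\sum_j v 0 j *: real_monomial (mi j)) = v.
  apply/rowP => i; rewrite mxE.
  transitivity (\sum_j v 0 j * real_coord (mi i) (real_monomial (mi j))).
    apply: (big_rec2 (fun p s => real_coord (mi i) p = s)) => [|j p s _ <-]; first exact: rc0.
    exact: real_coord_linear.
  rewrite (bigD1 i) //= real_coord_monomial eqxx mulr1 big1 ?addr0 // => j ji.
  rewrite real_coord_monomial /mi (inj_eq mfun_inj) (inj_eq enum_val_inj) (negbTE ji).
  by rewrite mulr0.
split=> // [a p q|p Sp].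
  by apply/rowP => i; rewrite !mxE real_coord_linear.
set q := \sum_i _.
have : p - q = 0.
  have Spq : supported (p - q).
    by rewrite addrC -scaleN1r; apply: lin => //; exact: comb.
  apply: real_coord_eq0 => m /Spq/mfun_surj[i <-].
  rewrite addrC -scaleN1r real_coord_linear mulN1r.
  have /rowP/(_ i) := combK (\row_i real_coord (mi i) p).
  rewrite !mxE -/q => qi; rewrite qi addNr //.
exact: subr0_eq.
Qed.

End SupportSpace.
End Coordinates.

Section OnShell.
Variables (R : realType) (n : nat) (A : 'rV[int]_n).
Let N := (n + n)%N.
Local Notation K := R[i].
Implicit Types (P Q : mpoly N K) (p q : realPoly R n) (z : 'rV[K]_n) (m : multinom N).

Let J : realPoly R n := moment_map R A.

Lemma meval_moment_map z : meval (real_coords z) J =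
  2^-1 * \sum_(j < n) (A 0 j)%:~R * (Re (z 0 j) ^+ 2 + Im (z 0 j) ^+ 2).
Proof.
rewrite /J /moment_map mevalZ raddf_sum; congr (_ * _); apply: eq_bigr => j _ /=.
rewrite mevalZ mevalD !rmorphXn /= !mevalXU /real_coords split_lshift split_rshift.
by [].
Qed.

Lemma moment_map_neq0 : A != 0 -> J != 0.
Proof.
move=> A0; have [j aj] : exists j, A 0 j != 0.
  by move: A0 => /rV0Pn.
apply: contra_neq aj => J0.
have := meval_moment_map (delta_mx 0 j : 'rV[K]_n).
rewrite J0 meval0 (bigD1 j) //= big1 ?addr0 => [|k kj]; last first.
  by rewrite !mxE (negbTE kj) /= expr0n addr0 mulr0.
rewrite !mxE !eqxx /= expr0n expr1n addr0 mulr1 => /esym/eqP.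
by rewrite mulf_eq0 invr_eq0 pnatr_eq0 /= intr_eq0 => /eqP.
Qed.

Lemma moment_map_invariant : invariant_of_degree A 2 J.
Proof.
split.
  move=> t z t1; rewrite !meval_moment_map; congr (_ * _); apply: eq_bigr => j _.
  congr (_ * _); rewrite mxE; apply: (@complexI R); rewrite !add_Re2_Im2 normrM.
  have tk (k : int) : `|t ^ k| = 1.
    case: k => k; first by rewrite -exprnP normrX t1 expr1n.
    by rewrite NegzE -exprnN normfV normrX t1 expr1n invr1.
  by rewrite tk mul1r.
rewrite /J /moment_map; apply: dhomogZ; apply: rpred_sum => j _.
by apply: dhomogZ; apply: dhomogD; 
  rewrite -[2%N]mul1n; apply: dhomogMn; rewrite dhomogX; apply/eqP; exact: mdeg1.
Qed.

Definition graded_support d : pred (multinom N) :=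
  fun m => (mweight A m == 0) && (mdeg m == d).

Lemma invariant_of_degree_supported d p :
  invariant_of_degree A d p <-> supported (graded_support d) p.
Proof.
rewrite invariant_of_degreeP; split=> h m nz.
  by have [e1 e2] := h m nz; rewrite /graded_support e1 e2 !eqxx.
by have /andP[/eqP e1 /eqP e2] := h m nz.
Qed.

Lemma complexify_moment_map_eigen (u : 'I_N -> K) a :
  (forall m, mweight A m = 0 -> mdeg m = 2%N -> \prod_i u i ^+ m i = a) ->
  mscale u (complexify J) = a *: complexify J.
Proof.
move=> h; apply/mscale_eigenP => m nz.
by have [m0 m2] := (invariant_of_degreeP A J 2).1 moment_map_invariant m nz; exact: h.
Qed.

Lemma supported_mul d p : supported (graded_support d) p ->
  supported (graded_support d.+2) (p * J).
Proof.
move=> /invariant_of_degree_supported[pi ph]; apply/invariant_of_degree_supported.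
have [Ji Jh] := moment_map_invariant; split.
  by move=> t z t1; rewrite !mevalM pi // Ji.
by rewrite -addn2; exact: dhomogM.
Qed.

Hypothesis A0 : A != 0.

Lemma mscale_factor (u : 'I_N -> K) (a b : K) q : b != 0 ->
  mscale u (complexify (q * J)) = a *: complexify (q * J) ->
  mscale u (complexify J) = b *: complexify J ->
  mscale u (complexify q) = (a / b) *: complexify q.
Proof.
move=> b0; rewrite complexifyM mscaleM => h1 h2.
have J0 : complexify J != 0.
  apply: contra_neq (moment_map_neq0 A0) => e; apply: complexify_inj.
  by rewrite e complexify0.
have e : b *: (mscale u (complexify q) * complexify J) = a *: (complexify q * complexify J).
  by rewrite -h1 h2 scalerAr.
apply: (mulIf J0).
rewrite -scalerAl -[LHS]scale1r -(mulVf b0) -scalerA e scalerA.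
by rewrite mulrC.
Qed.

(** Adding 2 to the degree instead of subtracting it from d leaves the support empty for d < 2. *)
Definition shifted_support d : pred (multinom N) :=
  fun m => (mweight A m == 0) && ((mdeg m).+2 == d).

(* The weights and degrees in q are read off from scalings of the variables that act on
   p and J by scalars, hence on q as well. *)
Lemma supported_div d p q : supported (graded_support d) p -> p = q * J ->
  supported (shifted_support d) q.
Proof.
move=> ps pq m nz; have two0 : (2 : K) != 0 by rewrite pnatr_eq0.
have w0 : mscale (fun k => 2 ^ coord_weight A k) (complexify q) = (1 / 1) *: complexify q.
  apply: mscale_factor; first exact: oner_neq0.
    rewrite -pq; apply/mscale_eigenP => m' /ps/andP[/eqP m0 _].
    by rewrite prod_exp_weight // m0 expr0z.
  by apply: complexify_moment_map_eigen => m' m0 _; rewrite prod_exp_weight // m0 expr0z.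
have dE (m' : multinom N) : \prod_(i < N) (2 : K) ^+ m' i = 2 ^+ mdeg m' by rewrite mdegE expr_sum.
have d0 : mscale (fun=> 2) (complexify q) = (2 ^+ d / 2 ^+ 2) *: complexify q.
  apply: mscale_factor; first exact: expf_neq0.
    by rewrite -pq; apply/mscale_eigenP => m' /ps/andP[_ /eqP <-].
  by apply: complexify_moment_map_eigen => m' _ m2; rewrite dE m2.
have /mscale_eigenP/(_ m nz) := w0; have /mscale_eigenP/(_ m nz) := d0.
rewrite dE prod_exp_weight // divr1 => e1 e2; apply/andP; split.
  move: e2; case: (mweight A m) => k; rewrite ?NegzE -?exprnN -?exprnP.
    by move/eqP; rewrite -natrX pnatr_eq1 -(expn0 2) eqn_exp2l.
  by move/eqP; rewrite invr_eq1 -natrX pnatr_eq1 -(expn0 2) eqn_exp2l.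
have /eqP : 2 ^+ (mdeg m).+2 = 2 ^+ d :> K by rewrite -[(mdeg m).+2]addn2 exprD e1 divfK ?expf_neq0.
by rewrite -!natrX eqr_nat eqn_exp2l.
Qed.

Lemma onshell_dim_basis d k : @onshell_dim R n A d k <->
  exists b : 'I_k -> realPoly R n,
    quotient_basis (supported (graded_support d)) (fun q => q * J) b.
Proof.
split=> -[b [bV h]]; exists b; split.
- by move=> i; apply/invariant_of_degree_supported.
- by move=> p /invariant_of_degree_supported; exact: h.
- by move=> i; apply/invariant_of_degree_supported.
- by move=> p /invariant_of_degree_supported; exact: h.
Qed.

Lemma graded_support_swap d m : graded_support d m -> graded_support d (mswap m).
Proof. by rewrite /graded_support mweight_swap mdeg_swap oppr_eq0. Qed.

Lemma shifted_support_swap d m : shifted_support d m -> shifted_support d (mswap m).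
Proof. by rewrite /shifted_support mweight_swap mdeg_swap oppr_eq0. Qed.

Lemma onshell_hilb_support M d : (d < M)%N ->
  (@onshell_hilb R n A d + #|support_set (n := n) M (shifted_support d)| =
   #|support_set (n := n) M (graded_support d)|)%N.
Proof.
move=> dM.
have gM m : graded_support d m -> (mdeg m < M)%N by case/andP=> _ /eqP ->.
have sM m : shifted_support d m -> (mdeg m < M)%N.
  case/andP=> _ /eqP e; apply: leq_ltn_trans dM.
  by rewrite -e (leq_trans (leqnSn _)).
have gc := support_coordinates R (@graded_support_swap d) gM.
have sc := support_coordinates R (@shifted_support_swap d) sM.
have lin (a : R) p q : (a *: p + q) * J = a *: (p * J) + q * J.
  by rewrite mulrDl scalerAl.
have inj p : p * J = 0 -> p = 0.
  by move/eqP; rewrite mulf_eq0 (negbTE (moment_map_neq0 A0)) orbF => /eqP.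
have sub p : supported (shifted_support d) p -> supported (graded_support d) (p * J).
  move=> ps; have [->|/eqP p0] := eqVneq p 0.
    by rewrite mul0r => m; rewrite complexify0 mcoeff0 eqxx.
  have [m mp] : exists m, mcoeff m (complexify p) != 0.
    apply: contrapT => h; apply: p0; apply: real_coord_eq0 => m nz; case: h; by exists m.
  have /andP[_ /eqP <-] := ps m mp; apply: supported_mul => m' nz.
  have /andP[w0 d0] := ps m' nz; rewrite /graded_support w0 /=.
  by rewrite -(eqn_add2l 2) !add2n (eqP d0); have /andP[_ /eqP ->] := ps m mp.
have [k [b hb]] := quotient_basis_exists gc sc lin sub (@supported_div d).
have hk : onshell_dim R A d k by apply/onshell_dim_basis; exists b.
(* A basis exists, so [xget] does not fall back on its default; whichever dimension it picks
   satisfies the counting equation. *)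
rewrite /onshell_hilb; case: xgetP => [j _ /onshell_dim_basis [b' hb']|/(_ k)/(_ hk) []].
exact: (quotient_basis_size gc sc lin inj sub (@supported_div d) hb').
Qed.

Lemma mdeg_mfun M (f : {ffun 'I_N -> 'I_M}) : mdeg (mfun f) = wdeg f.
Proof. by rewrite mdegE; apply: eq_bigr => i _; rewrite mfunE. Qed.

Lemma mweight_mfun M (f : {ffun 'I_N -> 'I_M}) :
  mweight A (mfun f) = wweight (coord_weight A) f.
Proof. by apply: eq_bigr => i _; rewrite mfunE. Qed.

Lemma onshell_hilb_count M d : (d < M)%N ->
  (@onshell_hilb R n A d + (if (2 <= d)%N then wcount (coord_weight A) M (d - 2) else 0%N) =
   wcount (coord_weight A) M d)%N.
Proof.
move=> dM; have := onshell_hilb_support dM.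
have -> : #|support_set (n := n) M (graded_support d)| = wcount (coord_weight A) M d.
  by apply: eq_card => f; rewrite !inE /graded_support mdeg_mfun mweight_mfun andbC.
move=> <-; congr (_ + _)%N; case: ifP => d2.
  apply: eq_card => f; rewrite !inE /shifted_support mdeg_mfun mweight_mfun andbC.
  by congr (_ && _); rewrite -(eqn_add2r 2) subnK // addn2.
apply/esym/eqP; rewrite cards_eq0; apply/eqP/setP => f; rewrite !inE.
by apply/negP => /andP[_ /eqP e]; move: d2; rewrite -e.
Qed.

End OnShell.

(** * The theorem *)

Section Expansion.
Variables (R : realType) (n : nat) (A : 'rV[int]_n).
Local Notation K := R[i].
Hypothesis A0 : A != 0.

Lemma onshell_expansion (v : {poly K}) :
  (forall M d, (d < M)%N ->
     \sum_(i < d.+1) (qgen K (coord_weight A))`_i *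
       (wcount (coord_weight A) M (d - i))%:R = v`_d) ->
  expansion_at0 (@onshell_hilb R n A) ((1 - 'X^2) * v) (qgen K (coord_weight A)).
Proof.
set q := qgen _ _; set wc := wcount _ => hv.
split=> [|d]; first by rewrite qgen_coef0 oner_eq0.
(* One truncation order d + 1 serves all counts of degree at most d, including those shifted by
   2. *)
rewrite mulrBl mul1r coefB coefXnM -(hv d.+1 d (ltnSn d)).
have h (i : 'I_d.+1) : (@onshell_hilb R n A (d - i))%:R =
    (wc d.+1 (d - i)%N)%:R - (if (2 <= d - i)%N then wc d.+1 (d - i - 2)%N else 0%N)%:R :> K.
  by rewrite /wc -(onshell_hilb_count R A0 (leq_ltn_trans (leq_subr i d) (ltnSn d))) natrD addrK.
under eq_bigr do rewrite h mulrBr.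
rewrite sumrB; congr (_ - _); case: ltnP => d2.
  by apply: big1 => i _; rewrite ltnNge (leq_trans (leq_subr _ _)) ?mulr0.
rewrite -(hv d.+1) ?ltnS ?leq_subr //.
rewrite (bigID (fun i : 'I_d.+1 => (i < (d - 2).+1)%N)) /=.
rewrite [X in _ + X]big1 ?addr0 => [|i]; last first.
  by rewrite -leqNgt => di; rewrite ifF ?mulr0 //; apply/negbTE; rewrite -leqNgt; lia.
have d2d : ((d - 2).+1 <= d.+1)%N by rewrite ltnS leq_subr.
rewrite (big_ord_widen_cond d.+1 xpredT (fun i => q`_i * (wc d.+1 (d - 2 - i)%N)%:R)) //.
apply: eq_bigr => i /= id2; rewrite ifT; last by lia.
by rewrite subnAC.
Qed.

End Expansion.

Section RootSums.
Variables (R : realType) (n : nat) (A : 'rV[int]_n) (L : R[i]).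
Local Notation K := R[i].
Local Notation w := (coord_weight A).
Implicit Types (C : 'rV[R]_n) (i j : 'I_n) (z : K).

Definition coord_real C (k : 'I_(n + n)) : R := match fintype.split k with
  | inl j => C 0 j | inr j => - C 0 j end.

Definition root_term C i z : K :=
  1 / ((C 0 i)%:C *
       \prod_(j < n | j != i)
         ((1 - z ^ (A 0 j) * real_pow L ((C 0 i + C 0 j) / C 0 i)) *
          (1 - z ^ (- A 0 j) * real_pow L ((C 0 i - C 0 j) / C 0 i)))).

Lemma prod_neq_lshift i (F : 'I_(n + n) -> K) :
  \prod_(k | k != lshift n i) F k =
  F (rshift n i) * \prod_(j < n | j != i) (F (lshift n j) * F (rshift n j)).
Proof.
rewrite big_split_ord /= big_split /= mulrCA; congr (_ * _).
rewrite (eq_bigl xpredT) => [|j]; last by rewrite eq_sym eq_lrshift.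
by rewrite (bigD1 i).
Qed.

Lemma prod_neq_rshift i (F : 'I_(n + n) -> K) :
  \prod_(k | k != rshift n i) F k =
  F (lshift n i) * \prod_(j < n | j != i) (F (lshift n j) * F (rshift n j)).
Proof.
rewrite big_split_ord /= big_split /= mulrA; congr (_ * _).
  rewrite (eq_bigl xpredT) => [|j]; last by rewrite eq_lrshift.
  by rewrite (bigD1 i).
by apply: eq_bigl => j; rewrite (inj_eq (@rshift_inj _ _)).
Qed.

Lemma coord_weight_lshift j : w (lshift n j) = A 0 j.
Proof. by rewrite /coord_weight split_lshift. Qed.
Lemma coord_weight_rshift j : w (rshift n j) = - A 0 j.
Proof. by rewrite /coord_weight split_rshift. Qed.
Lemma coord_real_lshift C j : coord_real C (lshift n j) = C 0 j.
Proof. by rewrite /coord_real split_lshift. Qed.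
Lemma coord_real_rshift C j : coord_real C (rshift n j) = - C 0 j.
Proof. by rewrite /coord_real split_rshift. Qed.

Definition coordE :=
  (coord_weight_lshift, coord_weight_rshift, coord_real_lshift, coord_real_rshift).

Hypothesis x2 : 1 - cexp L ^+ 2 != 0.

Lemma inv_cancel (u c P : K) : u != 0 -> u * (1 / (c * (u * P))) = 1 / (c * P).
Proof. by move=> u0; rewrite !mul1r mulrCA invfM mulVKf. Qed.

(** At this pole the partner factor [lshift n i] is 1 - x^2 and cancels the prefactor; the remaining
    factors come in the pairs of the root sum. *)
Lemma residue_term_rshift C i z : C 0 i != 0 -> z ^ A 0 i = 1 ->
  (1 - cexp L ^+ 2) * residue_term w L (coord_real C) (fun=> 0) (rshift n i) z =
  root_term C i z.
Proof.
move=> c0 zi; rewrite /residue_term prod_neq_rshift /node !coordE zi [1 * cexp _]mul1r.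
have -> : L * (1 + 0 + C 0 i * (- (1 + 0) / - C 0 i))%:C = L *+ 2.
  by rewrite -[RHS]mulr_natr -(rmorph_nat (real_complex R)); congr (_ * _%:C); field.
rewrite cexpMn opprK inv_cancel // /root_term; congr (1 / (_ * _)); apply: eq_bigr => j _.
rewrite !coordE /real_pow; congr ((1 - _ * cexp (L * _%:C)) * (1 - _ * cexp (L * _%:C))); by field.
Qed.

(** Exchanging the members of each pair replaces z by its inverse, and the prefactor [- C 0 i] gives
    the sign. *)
Lemma residue_term_lshift C i z : C 0 i != 0 -> z != 0 -> z ^ A 0 i = 1 ->
  (1 - cexp L ^+ 2) * residue_term w L (coord_real C) (fun=> 0) (lshift n i) z =
  - root_term C i z^-1.
Proof.
move=> c0 z0 zi; have zi' : z ^ (- A 0 i) = 1 by rewrite -exprz_inv exprz_inv -invr_expz zi invr1.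
rewrite /residue_term prod_neq_lshift /node !coordE zi' [1 * cexp _]mul1r.
have -> : L * (1 + 0 + - C 0 i * (- (1 + 0) / C 0 i))%:C = L *+ 2.
  by rewrite -[RHS]mulr_natr -(rmorph_nat (real_complex R)); congr (_ * _%:C); field.
rewrite cexpMn inv_cancel // realcN mulNr invrN mulrN; congr (- (1 / (_ * _))).
apply: eq_bigr => j _; rewrite !coordE /real_pow !exprz_inv opprK mulrC.
congr ((1 - _ * cexp (L * _%:C)) * (1 - _ * cexp (L * _%:C))); by field.
Qed.

Lemma root_sumE C i (zeta : K) : A 0 i != 0 -> (absz (A 0 i)).-primitive_root zeta ->
  root_sum A L C i = \sum_(k < absz (A 0 i)) root_term C i (zeta ^+ k).
Proof.
move=> ai zp.
have zX (z : K) : z ^ A 0 i = 1 <-> z ^+ `|A 0 i| = 1.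
  case: (A 0 i) => k; first by rewrite -exprnP.
  by rewrite NegzE -exprnN /=; split=> [/eqP|->]; rewrite ?invr1 // invr_eq1 => /eqP.
pose r := [seq zeta ^+ k | k : 'I_(absz (A 0 i))].
have ru : uniq r.
  rewrite map_inj_in_uniq ?enum_uniq // => k k' _ _ /eqP.
  by rewrite (eq_prim_root_expr zp) !modn_small // => /eqP /val_inj.
rewrite /root_sum (_ : [set zeta | _] = [set` r]).
  by rewrite -(fsbig_seq _ _ ru) /r big_map big_enum.
apply/seteqP; split=> z /=; rewrite zX.
  by move=> /(prim_rootP zp)[k ->]; apply/mapP; exists k; rewrite ?mem_enum.
by move=> /mapP[k _ ->]; rewrite -exprM mulnC exprM (prim_expr_order zp) expr1n.
Qed.

End RootSums.

Lemma prim_root_neq0 (F : fieldType) (a : nat) (z : F) : a.-primitive_root z -> z != 0.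
Proof.
move=> zp; apply: contra_eq_neq (prim_expr_order zp) => ->.
by rewrite expr0n gtn_eqF ?(prim_order_gt0 zp) // eq_sym oner_eq0.
Qed.

Lemma prim_root_inv (F : fieldType) (a : nat) (z : F) :
  a.-primitive_root z -> a.-primitive_root z^-1.
Proof.
move=> zp; have a0 := prim_order_gt0 zp; have z0 := prim_root_neq0 zp.
have -> : z^-1 = z ^+ a.-1.
  by apply: (mulfI z0); rewrite divff // -exprS prednK // prim_expr_order.
by rewrite (prim_root_exp_coprime _ zp); exact: coprimePn.
Qed.

Section Limit.
Variables (R : realType) (n : nat) (A : 'rV[int]_n).
Local Notation K := R[i].
Local Notation w := (coord_weight A).

Local Notation AR := (map_mx (fun a : int => a%:~R : R) A).

Lemma near_weights (e : R) : 0 < e ->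
  nbhs AR [set C : 'rV[R]_n | forall j, `|(A 0 j)%:~R - C 0 j| < e].
Proof.
move=> e0; exists (fun _ j => ball ((A 0 j)%:~R : R) e) => [i j|C hC j /=].
  by rewrite mxE ord1; exact: nbhsx_ballx.
exact: hC.
Qed.

(** Nodes with d = 0 are - 1 / c, so equal nodes mean equal entries up to sign and, [C] being
    generic, the same index i; its two partners never both have negative weight. *)
Lemma generic_deformations :
  (fun C : 'rV[R]_n => (coord_real C, fun=> 0 : R)) @ within (@generic R n) (nbhs AR)
    --> deformations w.
Proof.
move=> P [e e0 hP].
suff : nbhs AR [set C | generic C -> P (coord_real C, fun=> 0)] by [].
apply: filterS (near_weights e0) => C hC gC; apply: hP => [i j||i]; last by rewrite normr0.
  move=> wi wj _ /mulfI e1.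
  have {}e1 : coord_real C i = coord_real C j.
    by apply: invr_inj; apply: e1; rewrite addr0 oppr_eq0 oner_eq0.
  have gE (k l : 'I_n) : `|C 0 k| = `|C 0 l| -> k = l.
    by move=> kl; apply: contraTeq isT => /gC; rewrite kl eqxx.
  move: i wi e1; apply: ord_shift_ind => i; move: j wj; apply: ord_shift_ind => j;
    rewrite /negw !coordE ?oppr_lt0 => wj wi /(congr1 Num.norm);
    rewrite ?normrN => /gE ij; move: wi; rewrite ij //.
  - by rewrite ltNge ltW.
  - by rewrite ltNge ltW.
apply: ord_shift_ind => k; rewrite !coordE ?rmorphN /=; first by rewrite distrC.
by rewrite opprK addrC.
Qed.

Variables (L : K) (zeta : nat -> K).
Hypothesis zeta_prim : forall a, (0 < a)%N -> a.-primitive_root (zeta a).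
Hypothesis x2 : 1 - cexp L ^+ 2 != 0.

(** Exactly one of the two partners of i has negative weight when a_i is nonzero, and none when a_i
    = 0, where the factor [sgz] is 0. For negative a_i the sum is indexed by inverse roots. *)
Lemma residue_total_root_sum (C : 'rV[R]_n) : (forall i, A 0 i != 0 -> C 0 i != 0) ->
  (1 - cexp L ^+ 2) * residue_total w L zeta (coord_real C) (fun=> 0) =
  \sum_(i < n) (sgz (A 0 i))%:~R * root_sum A L C i.
Proof.
move=> c0; rewrite /residue_total big_mkcond big_split_ord /= -big_split /= mulr_sumr.
apply: eq_bigr => i _; rewrite /negw !coordE oppr_lt0 abszN.
have zm a k : (0 < a)%N -> (zeta a ^+ k) ^+ a = 1.
  by move=> a0; rewrite exprAC (prim_expr_order (zeta_prim a0)) expr1n.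
have zm' (b : int) k : b != 0 -> (zeta `|b| ^+ k) ^ b = 1.
  rewrite -absz_gt0 => b0; have := zm _ k b0; case: b b0 => m m0 /=; first by rewrite -exprnP.
  by move=> h; rewrite NegzE -exprnN h invr1.
case: (ltgtP (A 0 i) 0) => [ai|ai|ai].
- have ai0 : A 0 i != 0 by rewrite lt_eqF.
  have a0 : (0 < absz (A 0%R i))%N by rewrite absz_gt0.
  rewrite (ltr0_sgz ai) addr0 (root_sumE L C ai0 (prim_root_inv (zeta_prim a0))).
  rewrite mulNr mul1r mulr_sumr -sumrN; apply: eq_bigr => k _.
  rewrite residue_term_lshift ?zm' ?c0 ?exprVn //.
  by rewrite expf_neq0 // (prim_root_neq0 (zeta_prim a0)).
- have ai0 : A 0 i != 0 by rewrite gt_eqF.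
  have a0 : (0 < absz (A 0%R i))%N by rewrite absz_gt0.
  rewrite (gtr0_sgz ai) add0r (root_sumE L C ai0 (zeta_prim a0)).
  rewrite mul1r mulr_sumr; apply: eq_bigr => k _.
  by rewrite residue_term_rshift ?zm' ?c0.
by rewrite ai sgz0 addr0 mulr0 mul0r.
Qed.

End Limit.

Lemma tdeg_coord_weight_gt0 (n : nat) (A : 'rV[int]_n) : A != 0 -> (0 < tdeg (coord_weight A))%N.
Proof.
move=> /rV0Pn[j aj].
have [k wk] : exists k, negw (coord_weight A) k.
  case: (ltgtP (A 0 j) 0) aj => // aj _; [exists (lshift n j)|exists (rshift n j)];
    by rewrite /negw !coordE ?oppr_lt0.
rewrite /tdeg (bigD1 k) //=; apply: leq_trans (leq_addr _ _); exact: negw_absz_gt0.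
Qed.

Theorem theorem3p1 (R : realType) (n : nat) (A : 'rV[int]_n) (hA : A != 0) :
  exists p q : {poly R[i]},
    expansion_at0 (@onshell_hilb R n A) p q /\
    exists E : seq R[i],
      forall x : R[i], x != 0 -> x \notin E ->
      forall L : R[i], cexp L = x ->
        ((forall i : 'I_n, 0 < A 0 i) ->
           generic_limit A (fun C => \sum_(i < n) root_sum A L C i)
             (p.[x] / q.[x])) /\
        generic_limit A (fun C => \sum_(i < n) (sgz (A 0 i))%:~R * root_sum A L C i)
          (p.[x] / q.[x]).
Proof.
set w := coord_weight A.
have d0 : (0 < tdeg w)%N := tdeg_coord_weight_gt0 hA.
have [v [v1 hv]] := generating_function (R[i]) d0.
exists ((1 - 'X^2) * v.[1]), (qgen R[i] w); split; first exact: onshell_expansion.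
have prim (a : nat) : exists z : R[i], (0 < a)%N -> a.-primitive_root z.
  have [->|a0] := posnP a; first by exists 0.
  have [z zp] := @primitive_root_exists R[i] a a0 ltac:(by rewrite pnatr_eq0 -lt0n).
  by exists z.
pose zeta a := projT1 (cid (prim a)).
have zeta_prim a : (0 < a)%N -> a.-primitive_root (zeta a) := projT2 (cid (prim a)).
pose W := (weight_sum w + weight_sum w)%N.
(* All roots of unity of order at most W. Avoiding them keeps q nonzero at x, keeps clusters apart,
   and, as W is at least 2, gives x^2 different from 1 and L different from 0. *)
exists [seq zeta m ^+ k | m <- iota 1 W, k <- iota 0 m] => x x0 xE L Lx.
have xm m : (0 < m <= W)%N -> cexp L ^+ m != 1.
  move=> /andP[m0 mW]; apply: contraNneq xE; rewrite Lx => xm1.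
  have [k ->] := prim_rootP (zeta_prim m m0) xm1.
  by apply/allpairsPdep; exists m, (k : nat); rewrite !mem_iota add0n add1n ltnS m0 mW ltn_ord.
have W2 : (2 <= W)%N.
  have : (tdeg w <= weight_sum w)%N.
    by rewrite /tdeg /weight_sum big_mkcond; apply: leq_sum => i _; case: ifP.
  by rewrite /W; lia.
have L0 : L != 0.
  apply: contraNneq (xm 1%N _) => [->|]; first by rewrite cexp0 expr1n.
  by rewrite andTb ltnW.
have x2 : 1 - cexp L ^+ 2 != 0 by rewrite subr_eq0 eq_sym xm.
have lim := residue_total_limit zeta_prim xm L0 d0 hv.
set l := _ / _.
have goal2 : generic_limit A (fun C => \sum_(i < n) (sgz (A 0 i))%:~R * root_sum A L C i) l.
  have FF := within_filter (@generic R n) (nbhs_filter (map_mx (fun a : int => a%:~R : R) A)).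
  have lim' : cvgc (within (@generic R n) (nbhs (map_mx (fun a : int => a%:~R : R) A)))
      (fun C => residue_total w L zeta (coord_real C) (fun=> 0))
      (v.[1].[cexp L] / (qgen R[i] w).[cexp L]).
    exact: cvg_comp (@generic_deformations R n A) lim.
  have lx : l = (1 - cexp L ^+ 2) * (v.[1].[cexp L] / (qgen R[i] w).[cexp L]).
    by rewrite /l Lx hornerM hornerD hornerN hornerXn hornerC mulrA.
  rewrite /generic_limit lx; apply: cvg_trans (cvgcM FF (cvgc_cst FF _) lim').
  apply: near_eq_cvg.
  suff : nbhs (map_mx (fun a : int => a%:~R : R) A) [set C : 'rV[R]_n | generic C ->
      (1 - cexp L ^+ 2) * residue_total w L zeta (coord_real C) (fun=> 0) =
      \sum_(i < n) (sgz (A 0 i))%:~R * root_sum A L C i] by [].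
  (* Radius 1 suffices: a nonzero integer a_i has absolute value at least 1, so c_i cannot be 0. *)
  apply: filterS (near_weights A (@ltr01 R)) => C hC _.
  apply: (residue_total_root_sum zeta_prim x2) => i ai.
  apply: contraTneq (hC i) => ->; rewrite subr0 -leNgt -intr_norm.
  by rewrite (_ : 1 = 1%:~R) // ler_int; lia.
split; last exact: goal2.
move=> A_gt0; have e : (fun C : 'rV[R]_n => \sum_(i < n) (sgz (A 0 i))%:~R * root_sum A L C i) =
    (fun C => \sum_(i < n) root_sum A L C i).
  by apply/funext => C; apply: eq_bigr => i _; rewrite gtr0_sgz ?A_gt0 ?mul1r.
by rewrite -e; exact: goal2.
Qed.
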